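(* Let $\mathcal H$ be a Heyting category, let $A$ be an order partial applicative structure in $\mathcal H$ and let $\phi$ be a combinatory complete external filter of $A$. Let $F:\mathcal F\to\mathcal H$ be a separated fibred locale with a weakly generic vertical filter $C\in F_A$ such that Church's rule and the uniformity rule hold for $(F,C)$ and such that $C$ represents $\phi$. Then $F$ is equivalent (as a fibred category over $\mathcal H$) to the realizability fibration $\mathsf DA/\phi$.
   Context: All categories are small. A Heyting category is a regular category (finite limits and pullback-stable images) in which every poset $\mathrm{Sub}(X)$ has finite joins and every $f^{-1}:\mathrm{Sub}(Y)\to\mathrm{Sub}(X)$ has a right adjoint $\forall_f$ (it has a left adjoint $\exists_f$ by regularity). Set-builder notation refers to its internal language. Fibred locales. For a functor $F:\mathcal F\to\mathcal B$, an arrow $f:X\to Y$ of $\mathcal F$ is prone (Cartesian) if for all $g:X'\to Y$ and $h:FX'\to FX$ with $Fg=Ff\circ h$ there is a unique $k:X'\to X$ with $g=f\circ k$, $Fk=h$; supine means prone for $F^{op}$; vertical means sent to an identity. $F$ is a fibration if every $Y\to FX$ lifts to a prone arrow into $X$, a bifibration if moreover $F^{op}$ is a fibration. $F_X$ is the fibre over $X$ (objects over $X$, vertical arrows), $F_f:F_Y\to F_X$ is reindexing along $f:X\to Y$, and $\exists_f\dashv F_f$ is coindexing. A fibred locale is a faithful bifibration (so fibres are preorders, with order written $\le$) over a category with finite limits whose fibres have finite products preserved by reindexing, satisfying the Beck-Chevalley condition ($F_k\exists_h\simeq\exists_gF_f$ for each pullback square $f\circ g=h\circ k$, with $h,f$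 having common codomain, arranged as usual) and the Frobenius condition ($\exists_f(X\wedge F_fY)\simeq\exists_fX\wedge Y$). Then $\mathcal F$ has finite limits preserved by $F$; $\top_X$ is the top element of $F_X$ and $1=\top_1$ the terminal object of $\mathcal F$. $F$ is separated if $\exists_e(\top)\simeq\top$ for each regular epimorphism $e$ of the base. Order partial applicative structures. An order partial applicative structure in $\mathcal H$ is an object $A$ with a preorder $\le$ and a partial binary operator $(x,y)\mapsto xy$ with domain $D\subseteq A^2$ ($xy\downarrow$ means $(x,y)\in D$) such that $x\le x'$, $y\le y'$, $x'y'\downarrow$ imply $xy\downarrow$ and $xy\le x'y'$. Repeated application associates to the left. The partial combinatory functions $A^n\rightharpoonup A$ form the least class of partial functions (of all arities) containing the projections and closed under pointwise application. For $f:A^{n+1}\rightharpoonup A$, $[\![f]\!]=\{r\in A\mid \forall\vec x\in A^n.\,r\vec x\downarrow,\ \forall\vec y\in\mathrm{dom} f.\ r\vec y\downarrow\wedge r\vec y\le f(\vec y)\}$. $\mathbf DA$ is the set of downward closed subobjects (downsets) of $A$; for $U,V\in\mathbf DA$, $UV\downarrow$ iff $U\times V\subseteq D$, and then $UV=\{z\mid\exists x\in U,y\in V.\,z\le xy\}$. An external filter of $A$ is a subset $\phi\subseteq\mathbf DA$ that is upward closed under $\subseteq$ and closed under defined application; it is combinatory complete if $[\![f]\!]\in\phi$ for every partial combinatory $f$. Realizability fibration $\mathsf DA/\phi$ over $\mathcal H$: objects over $X$ are subobjects $Y\subseteq A\times X$ that are downward closed in the $A$-coordinate (families of downsets); a morphism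 $(X,Y)\to(X',Y')$ is an arrow $f:X\to X'$ of $\mathcal H$ for which there is $U\in\phi$ such that for all $u\in U$, $(a,x)\in Y$ we have $ua\downarrow$ and $(ua,f(x))\in Y'$. Vertical filters and genericity. A vertical filter is an object $C\in F_A$ with $F_s(C)\le F_t(C)$ for the projections $s(x,y)=x$, $t(x,y)=y$ from the order relation $\{(x,y):x\le y\}$ to $A$, and $F_p(C)\wedge F_q(C)\le F_a(C)$, where $p,q,a:D\to A$ are $p(x,y)=x$, $q(x,y)=y$, $a(x,y)=xy$. An object $C\in\mathcal F$ is weakly generic if for each $X\in\mathcal F$ there is a span $(p:Y\to C,\ s:Y\to X)$ with $p$ prone and $s$ supine. For $U\subseteq A$ write $C_U=F_{U\hookrightarrow A}(C)$. Prodo morphisms. A morphism $f:Y\to X$ in $\mathcal F$ is a prodo morphism if it is the restriction of the projection $C\times X\to X$ along a prone monomorphism $Y\hookrightarrow C\times X$ such that $FY\subseteq A\times FX$ is downward closed in the $A$-coordinate; elements of $Y$ are written $(a,x)$. Church's rule: for each pair of prodo morphisms $f:X\to Y$, $g:Y\to Z$ with $f$ supine there is a supine prodo morphism $e:W\to Z$ such that for all $(a,z)\in W$ and $(b,z)\in Y$, $ab\downarrow$ and $(ab,b,z)\in X$ (i.e. $(a,b,z)\mapsto(ab,b,z)$ is a well-defined morphism $W\times_ZY\to X$ of $\mathcal F$ over $Y$). Uniformity rule: for each supine prodo morphism $f:X\to Y$ and prone $g:Y\to Z$ there is a supine prodo morphism $e:W\to Z$ such that $W\times_ZY\subseteq X$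 as subobjects of $C\times Y$. $C$ represents $\phi$ if for each $U\in\mathbf DA$: the unique map $C_U\to1$ is supine if and only if $U\in\phi$. *)

(* Defs.v *)
From Corelib Require Import ssreflect.
From Stdlib Require Import ProofIrrelevance Setoid.

Set Implicit Arguments.
Unset Strict Implicit.
Unset Printing Implicit Defensive.

Record Cat := {
  Ob :> Type;
  Hom : Ob -> Ob -> Type;
  idm : forall X, Hom X X;
  comp : forall X Y Z, Hom Y Z -> Hom X Y -> Hom X Z;
  comp_idl : forall X Y (f : Hom X Y), comp (idm Y) f = f;
  comp_idr : forall X Y (f : Hom X Y), comp f (idm X) = f;
  comp_assoc : forall X Y Z W (f : Hom X Y) (g : Hom Y Z) (h : Hom Z W),
    comp h (comp g f) = comp (comp h g) f
}.

Arguments Hom {_} _ _.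
Arguments idm {_} _.
Arguments comp {_ X Y Z} _ _.

Declare Scope cat_scope.
Delimit Scope cat_scope with cat.
Local Open Scope cat_scope.
Notation "g ∘ f" := (comp g f) (at level 40, left associativity) : cat_scope.

Definition op_cat (B : Cat) : Cat :=
  {| Ob := B;
     Hom := fun X Y => @Hom B Y X;
     idm := fun X => @idm B X;
     comp := fun X Y Z (g : @Hom B Z Y) (f : @Hom B Y X) => f ∘ g;
     comp_idl := fun X Y f => comp_idr f;
     comp_idr := fun X Y f => comp_idl f;
     comp_assoc := fun X Y Z W f g h => eq_sym (comp_assoc h g f) |}.

Record Functor (E B : Cat) := {
  fob :> E -> B;
  fmor : forall X Y : E, Hom X Y -> Hom (fob X) (fob Y);
  fmor_id : forall X : E, fmor (idm X) = idm (fob X);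
  fmor_comp : forall (X Y Z : E) (f : Hom X Y) (g : Hom Y Z),
    fmor (g ∘ f) = fmor g ∘ fmor f
}.

Arguments fmor {E B} _ {X Y} _.

Definition op_functor (E B : Cat) (F : Functor E B) :
    Functor (op_cat E) (op_cat B) :=
  {| fob := F : op_cat E -> op_cat B;
     fmor := fun (X Y : op_cat E) (f : @Hom E Y X) => fmor F f;
     fmor_id := fun X => fmor_id F X;
     fmor_comp := fun (X Y Z : op_cat E) (f : @Hom E Y X) (g : @Hom E Z Y) =>
                    fmor_comp F g f |}.

Definition faithful (E B : Cat) (F : Functor E B) : Prop :=
  forall (X Y : E) (f g : Hom X Y), fmor F f = fmor F g -> f = g.

Definition mono {B : Cat} {X Y : B} (m : Hom X Y) : Prop :=
  forall I (x y : Hom I X), m ∘ x = m ∘ y -> x = y.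

Definition iso {B : Cat} {X Y : B} (f : Hom X Y) : Prop :=
  exists g : Hom Y X, g ∘ f = idm X /\ f ∘ g = idm Y.

Definition is_terminal {B : Cat} (T : B) : Prop :=
  forall X : B, exists! t : Hom X T, True.

Definition is_product {B : Cat} {X Y P : B} (p : Hom P X) (q : Hom P Y) : Prop :=
  forall I (x : Hom I X) (y : Hom I Y), exists! k : Hom I P, p ∘ k = x /\ q ∘ k = y.

Definition is_pullback {B : Cat} {X Y Z P : B} (f : Hom X Z) (g : Hom Y Z)
    (p : Hom P X) (q : Hom P Y) : Prop :=
  f ∘ p = g ∘ q /\
  forall I (x : Hom I X) (y : Hom I Y), f ∘ x = g ∘ y ->
    exists! k : Hom I P, p ∘ k = x /\ q ∘ k = y.

Definition regular_epi {B : Cat} {X Y : B} (e : Hom X Y) : Prop :=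
  exists (K : B) (p q : Hom K X), e ∘ p = e ∘ q /\
    forall Z (f : Hom X Z), f ∘ p = f ∘ q -> exists! k : Hom Y Z, k ∘ e = f.

(** The generalized element [x] factors through [m]; for [m] monic this is
    membership of [x] in the subobject [m]. *)
Definition mem {B : Cat} {I X M : B} (x : Hom I X) (m : Hom M X) : Prop :=
  exists k : Hom I M, m ∘ k = x.

Notation "x ∈ m" := (mem x m) (at level 70) : cat_scope.

Record Sub {B : Cat} (X : B) := {
  sub_ob : B;
  sub_map :> Hom sub_ob X;
  sub_mono : mono sub_map
}.

(** [Sub X] is used as a preordered collection; its poset reflection is the
    poset of subobjects. *)
Definition sub_le {B : Cat} {X : B} (U V : Sub X) : Prop := U ∈ V.
Definition sub_eq {B : Cat} {X : B} (U V : Sub X) : Prop :=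
  sub_le U V /\ sub_le V U.

Notation "U ⊆ V" := (sub_le U V) (at level 70) : cat_scope.

(** Binary products could be obtained from [one] and [pb]; they are chosen
    separately only for convenience. *)
Record FinLimCat := {
  fl_cat :> Cat;
  one : fl_cat;
  one_terminal : is_terminal one;
  prod : fl_cat -> fl_cat -> fl_cat;
  pi1 : forall {X Y}, Hom (prod X Y) X;
  pi2 : forall {X Y}, Hom (prod X Y) Y;
  pair : forall {I X Y}, Hom I X -> Hom I Y -> Hom I (prod X Y);
  pi1_pair : forall I X Y (x : Hom I X) (y : Hom I Y), pi1 ∘ pair x y = x;
  pi2_pair : forall I X Y (x : Hom I X) (y : Hom I Y), pi2 ∘ pair x y = y;
  pair_eta : forall I X Y (z : Hom I (prod X Y)), pair (pi1 ∘ z) (pi2 ∘ z) = z;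
  pb : forall {X Y Z : fl_cat}, Hom X Z -> Hom Y Z -> fl_cat;
  pb1 : forall {X Y Z : fl_cat} (f : Hom X Z) (g : Hom Y Z), Hom (pb f g) X;
  pb2 : forall {X Y Z : fl_cat} (f : Hom X Z) (g : Hom Y Z), Hom (pb f g) Y;
  pb_pullback : forall (X Y Z : fl_cat) (f : Hom X Z) (g : Hom Y Z),
    is_pullback f g (pb1 f g) (pb2 f g)
}.

Arguments one {_}.
Arguments prod {_} _ _.
Arguments pi1 {_ X Y}.
Arguments pi2 {_ X Y}.
Arguments pair {_ I X Y} _ _.
Arguments pb {_ X Y Z} _ _.
Arguments pb1 {_ X Y Z} _ _.
Arguments pb2 {_ X Y Z} _ _.

Notation "X ⊗ Y" := (prod X Y) (at level 35, right associativity) : cat_scope.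
Notation "⟨ x , y ⟩" := (pair x y) (format "⟨ x ,  y ⟩") : cat_scope.

Definition prod_mor {B : FinLimCat} {X Y X' Y' : B} (f : Hom X X') (g : Hom Y Y') :
    Hom (X ⊗ Y) (X' ⊗ Y') := ⟨f ∘ pi1, g ∘ pi2⟩.

Lemma comp_mono (B : Cat) (X Y Z : B) (g : Hom Y Z) (f : Hom X Y) :
  mono g -> mono f -> mono (g ∘ f).
Proof. by move=> hg hf I x y e; apply: hf; apply: hg; rewrite !comp_assoc. Qed.

Lemma pb_joint_mono (B : FinLimCat) (X Y Z : B) (f : Hom X Z) (g : Hom Y Z) I
    (x y : Hom I (pb f g)) :
  pb1 f g ∘ x = pb1 f g ∘ y -> pb2 f g ∘ x = pb2 f g ∘ y -> x = y.
Proof.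
move=> e1 e2; case: (pb_pullback f g) => [e /(_ I (pb1 f g ∘ x) (pb2 f g ∘ x))].
rewrite !comp_assoc e => /(_ eq_refl) [k [_ hk]].
by rewrite -(hk x) // -(hk y).
Qed.

Lemma pb1_mono (B : FinLimCat) (X Y Z : B) (f : Hom X Z) (g : Hom Y Z) :
  mono g -> mono (pb1 f g).
Proof.
move=> hg I x y e; apply: pb_joint_mono => //; apply: hg.
by rewrite !comp_assoc -(proj1 (pb_pullback f g)) -!comp_assoc e.
Qed.

Lemma pair_comp (B : FinLimCat) (J I X Y : B) (x : Hom I X) (y : Hom I Y) (h : Hom J I) :
  ⟨x, y⟩ ∘ h = ⟨x ∘ h, y ∘ h⟩.
Proof. by rewrite -(pair_eta (⟨x, y⟩ ∘ h)) !comp_assoc pi1_pair pi2_pair. Qed.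

Lemma pair_inj (B : FinLimCat) (I X Y : B) (x x' : Hom I X) (y y' : Hom I Y) :
  ⟨x, y⟩ = ⟨x', y'⟩ -> x = x' /\ y = y'.
Proof.
by move=> e; rewrite -(pi1_pair x y) -{2}(pi2_pair x y) e pi1_pair pi2_pair.
Qed.

Lemma prod_mor_mono (B : FinLimCat) (X Y X' Y' : B) (f : Hom X X') (g : Hom Y Y') :
  mono f -> mono g -> mono (prod_mor f g).
Proof.
move=> hf hg I x y; rewrite /prod_mor !pair_comp -!comp_assoc => /pair_inj [e1 e2].
by rewrite -(pair_eta x) -(pair_eta y) (hf _ _ _ e1) (hg _ _ _ e2).
Qed.

Lemma id_mono (B : Cat) (X : B) : mono (idm X).
Proof. by move=> I x y; rewrite !comp_idl. Qed.

Definition sub_top {B : Cat} (X : B) : Sub X := {| sub_map := idm X; sub_mono := @id_mono B X |}.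

Definition sub_pull {B : FinLimCat} {X Y : B} (f : Hom X Y) (U : Sub Y) : Sub X :=
  {| sub_map := pb1 f U; sub_mono := pb1_mono (@sub_mono _ _ U) |}.

Definition sub_sum {B : Cat} {X : B} (U : Sub X) (V : Sub (sub_ob U)) : Sub X :=
  {| sub_map := U ∘ V; sub_mono := comp_mono (@sub_mono _ _ U) (@sub_mono _ _ V) |}.

Definition sub_meet {B : FinLimCat} {X : B} (U V : Sub X) : Sub X :=
  sub_sum (sub_pull U V).

Definition sub_prod {B : FinLimCat} {X Y : B} (U : Sub X) (V : Sub Y) : Sub (X ⊗ Y) :=
  {| sub_map := prod_mor U V;
     sub_mono := prod_mor_mono (@sub_mono _ _ U) (@sub_mono _ _ V) |}.

(** Images give the left adjoints [∃_f]; stability of joins follows from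
    [sub_all_adj]. *)
Record HeytingCat := {
  hc_cat :> FinLimCat;
  im : forall {X Y : hc_cat}, Hom X Y -> Sub Y;
  im_fact : forall (X Y : hc_cat) (f : Hom X Y), f ∈ im f;
  im_min : forall (X Y : hc_cat) (f : Hom X Y) (V : Sub Y), f ∈ V -> im f ⊆ V;
  im_stable : forall (X Y Y' : hc_cat) (f : Hom X Y) (g : Hom Y' Y),
    sub_eq (sub_pull g (im f)) (im (pb1 g f));
  sub_bot : forall X : hc_cat, Sub X;
  sub_bot_min : forall (X : hc_cat) (U : Sub X), sub_bot X ⊆ U;
  sub_join : forall {X : hc_cat}, Sub X -> Sub X -> Sub X;
  sub_join_lub : forall (X : hc_cat) (U V W : Sub X),
    sub_join U V ⊆ W <-> U ⊆ W /\ V ⊆ W;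
  sub_all : forall {X Y : hc_cat}, Hom X Y -> Sub X -> Sub Y;
  sub_all_adj : forall (X Y : hc_cat) (f : Hom X Y) (U : Sub X) (V : Sub Y),
    V ⊆ sub_all f U <-> sub_pull f V ⊆ U
}.

Arguments im {_ X Y} _.
Arguments sub_join {_ X} _ _.
Arguments sub_all {_ X Y} _ _.

Record PMap {B : Cat} (X Y : B) := {
  pm_dom : Sub X;
  pm_map : Hom (sub_ob pm_dom) Y
}.

(** "[f(x)] is defined and equal to [y]". *)
Definition pm_val {B : Cat} {X Y : B} (f : PMap X Y) {I} (x : Hom I X) (y : Hom I Y) : Prop :=
  exists k, pm_dom f ∘ k = x /\ pm_map f ∘ k = y.

Definition pm_eq {B : Cat} {X Y : B} (f g : PMap X Y) : Prop :=
  forall I (x : Hom I X) (y : Hom I Y), pm_val f x y <-> pm_val g x y.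

Definition pm_total {B : Cat} {X Y : B} (f : Hom X Y) : PMap X Y :=
  {| pm_dom := sub_top X; pm_map := f |}.

Definition pm_precomp {B : FinLimCat} {X Y Z : B} (f : PMap Y Z) (h : Hom X Y) : PMap X Z :=
  {| pm_dom := sub_pull h (pm_dom f);
     pm_map := pm_map f ∘ pb2 h (pm_dom f) |}.

(** The conditions are Horn sequents of the internal language, hence stated for
    generalized elements. *)
Record OPAS (B : FinLimCat) := {
  carrier :> B;
  leq : Sub (carrier ⊗ carrier);
  leq_refl : forall I (x : Hom I carrier), ⟨x, x⟩ ∈ leq;
  leq_trans : forall I (x y z : Hom I carrier),
    ⟨x, y⟩ ∈ leq -> ⟨y, z⟩ ∈ leq -> ⟨x, z⟩ ∈ leq;
  app : PMap (carrier ⊗ carrier) carrier;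
  app_mono : forall I (x x' y y' z' : Hom I carrier),
    ⟨x, x'⟩ ∈ leq -> ⟨y, y'⟩ ∈ leq -> pm_val app ⟨x', y'⟩ z' ->
    exists z, pm_val app ⟨x, y⟩ z /\ ⟨z, z'⟩ ∈ leq
}.

Arguments leq {B} _.
Arguments app {B} _.

Definition downset {B : FinLimCat} {A : OPAS B} (U : Sub A) : Prop :=
  forall I (a a' : Hom I A), ⟨a, a'⟩ ∈ leq A -> a' ∈ U -> a ∈ U.

Definition down_closed {B : FinLimCat} (A : OPAS B) {X Y : B} (m : Hom Y (A ⊗ X)) : Prop :=
  forall I (a a' : Hom I A) (x : Hom I X),
    ⟨a, a'⟩ ∈ leq A -> ⟨a', x⟩ ∈ m -> ⟨a, x⟩ ∈ m.

(** Pointwise application, with domain [{x | f(x)↓, g(x)↓, f(x)g(x)↓}]. *)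
Section PointwiseApp.
Variables (B : FinLimCat) (A : OPAS B) (X : B) (f g : PMap X A).
Let both : Sub X := sub_meet (pm_dom f) (pm_dom g).
Let args : Hom (sub_ob both) (A ⊗ A) :=
  ⟨pm_map f ∘ pb1 (pm_dom f) (pm_dom g), pm_map g ∘ pb2 (pm_dom f) (pm_dom g)⟩.
Definition pm_app : PMap X A :=
  {| pm_dom := sub_sum (U := both) (sub_pull args (pm_dom (app A)));
     pm_map := pm_map (app A) ∘ pb2 args (pm_dom (app A)) |}.
End PointwiseApp.

(** [{x | f(x)↓, f(x) ≤ g(x)}] for total [g]. *)
Definition pm_le {B : FinLimCat} {A : OPAS B} {X : B} (f : PMap X A) (g : Hom X A) : Sub X :=
  sub_sum (sub_pull ⟨pm_map f, g ∘ pm_dom f⟩ (leq A)).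

(** [A^0 = 1] and [A^(n+1) = A^n ⊗ A], the last factor being the last argument. *)
Fixpoint pow {B : FinLimCat} (A : B) (n : nat) : B :=
  match n with O => one | S n => pow A n ⊗ A end.

Inductive is_proj {B : FinLimCat} (A : B) : forall n, Hom (pow A n) A -> Prop :=
| proj_last n : is_proj (n := S n) pi2
| proj_prev n (p : Hom (pow A n) A) : is_proj p -> is_proj (n := S n) (p ∘ pi1).

(** A partial function is a [PMap] up to [pm_eq]. *)
Inductive pcf {B : FinLimCat} (A : OPAS B) (n : nat) : PMap (pow A n) A -> Prop :=
| pcf_proj (p : Hom (pow A n) A) : is_proj p -> pcf (pm_total p)
| pcf_app (f g : PMap (pow A n) A) : pcf f -> pcf g -> pcf (pm_app f g)
| pcf_eq (f g : PMap (pow A n) A) : pm_eq f g -> pcf f -> pcf g.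

(** The partial function [(r, x1, .., xn) ↦ r x1 .. xn]. *)
Fixpoint iapp {B : FinLimCat} (A : OPAS B) (n : nat) : PMap (A ⊗ pow A n) A :=
  match n return PMap (A ⊗ pow A n) A with
  | O => pm_total pi1
  | S n => pm_app (pm_precomp (iapp A n) (prod_mor (idm A) pi1))
                  (pm_total (X := A ⊗ (pow A n ⊗ A)) (pi2 ∘ pi2))
  end.

(** The object of realizers of [f]; quantification over [y ∈ dom f] is [∀] along
    the projection [A ⊗ dom f → A]. *)
Definition realizers {H : HeytingCat} {A : OPAS H} {n : nat}
    (f : PMap (pow A (S n)) A) : Sub A :=
  sub_meet
    (sub_all pi1 (pm_dom (iapp A n)))
    (sub_all pi1
      (pm_le (pm_precomp (iapp A (S n)) (prod_mor (idm A) (pm_dom f)))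
             (pm_map f ∘ pi2))).

(** [UV = {z | ∃ x ∈ U, y ∈ V. z ≤ xy}], where [k] witnesses [U × V ⊆ D]. *)
Definition sub_app {H : HeytingCat} {A : OPAS H} (U V : Sub A)
    (k : Hom (sub_ob U ⊗ sub_ob V) (sub_ob (pm_dom (app A)))) : Sub A :=
  im ((pi1 ∘ leq A) ∘ pb1 (pi2 ∘ leq A) (pm_map (app A) ∘ k)).

Record external_filter {H : HeytingCat} {A : OPAS H} (phi : Sub A -> Prop) : Prop := {
  filter_down : forall U, phi U -> downset U;
  filter_up : forall U V, phi U -> downset V -> U ⊆ V -> phi V;
  filter_app : forall U V, phi U -> phi V ->
    forall k, pm_dom (app A) ∘ k = sub_prod U V -> phi (sub_app k)
}.

Definition comb_complete {H : HeytingCat} {A : OPAS H} (phi : Sub A -> Prop) : Prop :=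
  forall n (f : PMap (pow A (S n)) A), pcf f -> phi (realizers f).

Lemma mem_comp (B : Cat) (I J X M : B) (x : Hom I X) (m : Hom M X) (h : Hom J I) :
  x ∈ m -> x ∘ h ∈ m.
Proof. by move=> [k <-]; exists (k ∘ h); rewrite comp_assoc. Qed.

Lemma mem_le (B : Cat) (I X : B) (x : Hom I X) (U V : Sub X) : U ⊆ V -> x ∈ U -> x ∈ V.
Proof. by move=> [k hk] [l <-]; exists (k ∘ l); rewrite comp_assoc hk. Qed.

Lemma pb_lift (B : FinLimCat) (X Y Z I : B) (f : Hom X Z) (g : Hom Y Z)
    (x : Hom I X) (y : Hom I Y) :
  f ∘ x = g ∘ y -> exists k, pb1 f g ∘ k = x /\ pb2 f g ∘ k = y.
Proof. by case: (pb_pullback f g) => _ h /h [k [hk _]]; exists k. Qed.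

Lemma pb_comm (B : FinLimCat) (X Y Z : B) (f : Hom X Z) (g : Hom Y Z) :
  f ∘ pb1 f g = g ∘ pb2 f g.
Proof. by case: (pb_pullback f g). Qed.

Lemma mem_pull (B : FinLimCat) (I X Y : B) (f : Hom X Y) (U : Sub Y) (x : Hom I X) :
  x ∈ sub_pull f U <-> f ∘ x ∈ U.
Proof.
split=> [[k <-]|[k hk]].
  by exists (pb2 f U ∘ k); rewrite !comp_assoc -pb_comm.
by case: (pb_lift (eq_sym hk)) => l [hl _]; exists l.
Qed.

Lemma mem_meet (B : FinLimCat) (I X : B) (U V : Sub X) (x : Hom I X) :
  x ∈ sub_meet U V <-> x ∈ U /\ x ∈ V.
Proof.
split=> [[k <-]|[[k hk] [l hl]]].
  split; first by exists (pb1 U V ∘ k); rewrite !comp_assoc.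
  by exists (pb2 U V ∘ k); rewrite /= !comp_assoc pb_comm.
have [j [hj _]] : exists j, pb1 U V ∘ j = k /\ pb2 U V ∘ j = l.
  by apply: pb_lift; rewrite hk hl.
by exists j; rewrite /= -comp_assoc hj.
Qed.

Lemma mem_all (H : HeytingCat) (I X Y : H) (f : Hom X Y) (U : Sub X) (y : Hom I Y) :
  y ∈ sub_all f U <->
  forall J (h : Hom J I) (x : Hom J X), f ∘ x = y ∘ h -> x ∈ U.
Proof.
split=> [hy J h x e|hy].
  have /(mem_le (x := x)) : sub_pull f (sub_all f U) ⊆ U.
    by apply/sub_all_adj; exists (idm _); rewrite comp_idr.
  by apply; apply/mem_pull; rewrite e; apply: mem_comp.
have hV : im y ⊆ sub_all f U; last by apply: mem_le hV _; apply: im_fact.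
apply/sub_all_adj; case: (im_stable y f) => h _.
apply: (mem_le _ h); apply: im_min; apply: (hy _ (pb2 f y)); exact: pb_comm.
Qed.

(** Membership in a subobject is local for the image of [e] being everything. *)
Lemma mem_cover (H : HeytingCat) (I J X : H) (e : Hom J I) (x : Hom I X) (U : Sub X) :
  idm I ∈ im e -> x ∘ e ∈ U -> x ∈ U.
Proof.
move=> he hx; rewrite -(comp_idr x); apply/mem_pull.
by apply: (mem_le _ he); apply: im_min; apply/mem_pull.
Qed.

Lemma pm_val_comp (B : Cat) (X Y I J : B) (f : PMap X Y) (x : Hom I X) (y : Hom I Y)
    (h : Hom J I) : pm_val f x y -> pm_val f (x ∘ h) (y ∘ h).
Proof. by move=> [k [<- <-]]; exists (k ∘ h); rewrite !comp_assoc. Qed.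

Lemma pm_val_fun (B : Cat) (X Y I : B) (f : PMap X Y) (x : Hom I X) (y y' : Hom I Y) :
  pm_val f x y -> pm_val f x y' -> y = y'.
Proof. by move=> [k [<- <-]] [l [e <-]]; rewrite (sub_mono e). Qed.

Lemma pm_domP (B : Cat) (X Y I : B) (f : PMap X Y) (x : Hom I X) :
  x ∈ pm_dom f <-> exists y, pm_val f x y.
Proof.
split=> [[k <-]|[y [k [hk _]]]]; last by exists k.
by exists (pm_map f ∘ k), k.
Qed.

Lemma pm_total_val (B : Cat) (X Y I : B) (f : Hom X Y) (x : Hom I X) (y : Hom I Y) :
  pm_val (pm_total f) x y <-> f ∘ x = y.
Proof.
split=> [[k [/= <- <-]]|<-]; first by rewrite comp_idl.
by exists x; rewrite /= comp_idl.
Qed.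

Lemma pm_precomp_val (B : FinLimCat) (X Y Z I : B) (f : PMap Y Z) (h : Hom X Y)
    (x : Hom I X) (z : Hom I Z) :
  pm_val (pm_precomp f h) x z <-> pm_val f (h ∘ x) z.
Proof.
split=> [[k [<- <-]]|[k [hk <-]]].
  by exists (pb2 h (pm_dom f) ∘ k); rewrite /= !comp_assoc pb_comm.
case: (pb_lift (eq_sym hk)) => l [h1 h2].
by exists l; rewrite /= -comp_assoc h2.
Qed.

Lemma pm_app_val (B : FinLimCat) (A : OPAS B) (X I : B) (f g : PMap X A)
    (x : Hom I X) (z : Hom I A) :
  pm_val (pm_app f g) x z <->
  exists u v, pm_val f x u /\ pm_val g x v /\ pm_val (app A) ⟨u, v⟩ z.
Proof.
split=> [[k [<- <-]]|[u [v [[k [hk hu]] [[l [hl hv]] [d [hd hz]]]]]]].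
{ set d := pm_dom (app A); set args := ⟨pm_map f ∘ pb1 (pm_dom f) (pm_dom g),
    pm_map g ∘ pb2 (pm_dom f) (pm_dom g)⟩.
  have e : args ∘ pb1 args d = d ∘ pb2 args d by exact: pb_comm.
  exists (pm_map f ∘ pb1 (pm_dom f) (pm_dom g) ∘ pb1 args d ∘ k).
  exists (pm_map g ∘ pb2 (pm_dom f) (pm_dom g) ∘ pb1 args d ∘ k).
  split; [|split].
  - by exists (pb1 (pm_dom f) (pm_dom g) ∘ pb1 args d ∘ k); rewrite /= !comp_assoc.
  - by exists (pb2 (pm_dom f) (pm_dom g) ∘ pb1 args d ∘ k); rewrite /= !comp_assoc -pb_comm.
  - exists (pb2 args d ∘ k); rewrite /= !comp_assoc; split=> //.
    by rewrite -/d -e /args !pair_comp. }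
have [j [j1 j2]] : exists j, pb1 (pm_dom f) (pm_dom g) ∘ j = k /\ pb2 (pm_dom f) (pm_dom g) ∘ j = l.
  by apply: pb_lift; rewrite hk hl.
have e : ⟨pm_map f ∘ pb1 (pm_dom f) (pm_dom g), pm_map g ∘ pb2 (pm_dom f) (pm_dom g)⟩ ∘ j
    = pm_dom (app A) ∘ d.
  by rewrite pair_comp -!comp_assoc j1 j2 hu hv hd.
case: (pb_lift e) => i [i1 i2]; exists i; split => /=.
  by rewrite -!comp_assoc i1 j1.
by rewrite -comp_assoc i2.
Qed.

Lemma pm_leP (B : FinLimCat) (A : OPAS B) (X I : B) (f : PMap X A) (g : Hom X A)
    (x : Hom I X) :
  x ∈ pm_le f g <-> exists y, pm_val f x y /\ ⟨y, g ∘ x⟩ ∈ leq A.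
Proof.
split=> [[k <-]|[y [[k [<- <-]] hy]]].
  set m := ⟨pm_map f, g ∘ pm_dom f⟩.
  exists (pm_map f ∘ (pb1 m (leq A) ∘ k)); split.
    by exists (pb1 m (leq A) ∘ k); rewrite /= !comp_assoc.
  have e : m ∘ pb1 m (leq A) = leq A ∘ pb2 m (leq A) by exact: pb_comm.
  exists (pb2 m (leq A) ∘ k); rewrite comp_assoc -e /m !pair_comp /=.
  by rewrite !comp_assoc.
have: ⟨pm_map f, g ∘ pm_dom f⟩ ∘ k ∈ leq A by rewrite pair_comp -comp_assoc.
move=> /mem_pull [l hl]; exists l.
by rewrite /= -comp_assoc; congr comp.
Qed.

Lemma iapp0_val (B : FinLimCat) (A : OPAS B) (I : B) (r z : Hom I A) (o : Hom I one) :
  pm_val (iapp A 0) ⟨r, o⟩ z <-> r = z.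
Proof. by rewrite pm_total_val pi1_pair. Qed.

Lemma iappS_val (B : FinLimCat) (A : OPAS B) (n : nat) (I : B) (r x z : Hom I A)
    (xs : Hom I (pow A n)) :
  pm_val (iapp A (S n)) ⟨r, ⟨xs, x⟩⟩ z <->
  exists w, pm_val (iapp A n) ⟨r, xs⟩ w /\ pm_val (app A) ⟨w, x⟩ z.
Proof.
have e : prod_mor (idm A) pi1 ∘ ⟨r, ⟨xs, x⟩⟩ = ⟨r, xs⟩.
  by rewrite /prod_mor pair_comp -!comp_assoc pi1_pair pi2_pair pi1_pair comp_idl.
rewrite [iapp A (S n)]/= pm_app_val; split=> [[u [v]]|[w [h1 h2]]].
  rewrite pm_precomp_val e pm_total_val -comp_assoc !pi2_pair => -[hu [<- hz]].
  by exists u.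
exists w, x; rewrite pm_precomp_val e pm_total_val -comp_assoc !pi2_pair.
by split.
Qed.

Lemma realizersP (H : HeytingCat) (A : OPAS H) (n : nat) (f : PMap (pow A (S n)) A)
    (I : H) (r : Hom I A) :
  r ∈ realizers f <->
  (forall J (h : Hom J I) (xs : Hom J (pow A n)),
     exists w, pm_val (iapp A n) ⟨r ∘ h, xs⟩ w) /\
  (forall J (h : Hom J I) (ys : Hom J (pow A (S n))) v, pm_val f ys v ->
     exists w, pm_val (iapp A (S n)) ⟨r ∘ h, ys⟩ w /\ ⟨w, v⟩ ∈ leq A).
Proof.
rewrite mem_meet !mem_all; split=> -[h1 h2]; split=> J h.
- by move=> xs; apply/pm_domP; apply: h1; rewrite pi1_pair.
- move=> ys v [k [<- <-]].
  have /pm_leP : ⟨r ∘ h, k⟩ ∈ pm_le (pm_precomp (iapp A (S n)) (prod_mor (idm A) (pm_dom f)))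
             (pm_map f ∘ pi2) by apply: h2; rewrite pi1_pair.
  move=> [w []]; rewrite pm_precomp_val /prod_mor pair_comp -!comp_assoc.
  by rewrite pi1_pair pi2_pair comp_idl => ? ?; exists w.
- by move=> x e; apply/pm_domP; rewrite -(pair_eta x) e.
- move=> x e; apply/pm_leP.
  have hv : pm_val f (pm_dom f ∘ (pi2 ∘ x)) (pm_map f ∘ (pi2 ∘ x)) by exists (pi2 ∘ x).
  case: (h2 _ h _ _ hv) => w [hw hle]; exists w.
  rewrite pm_precomp_val /prod_mor pair_comp -!comp_assoc comp_idl e.
  by split.
Qed.

(** [z ∈ UV] may be eliminated, up to a cover, into any subobject membership. *)
Lemma sub_appE (H : HeytingCat) (A : OPAS H) (U V : Sub A) k (I X : H)
    (z : Hom I A) (x : Hom I X) (S : Sub X) :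
  pm_dom (app A) ∘ k = sub_prod U V -> z ∈ sub_app k ->
  (forall J (h : Hom J I) (u v w : Hom J A), u ∈ U -> v ∈ V ->
     pm_val (app A) ⟨u, v⟩ w -> ⟨z ∘ h, w⟩ ∈ leq A -> x ∘ h ∈ S) ->
  x ∈ S.
Proof.
move=> hk hz hS; rewrite /sub_app in hz.
set m := (_ ∘ pb1 _ _) in hz.
have hc : idm I ∈ im (pb1 z m).
  case: (im_stable m z) => h _; apply: (mem_le h); apply/mem_pull.
  by rewrite comp_idr.
apply: (mem_cover hc); set q := pb2 z m.
have ez : z ∘ pb1 z m = m ∘ q by exact: pb_comm.
set t := pi2 ∘ leq A in m hz hc q ez *; set c := pm_map (app A) ∘ k in m hz hc q ez *.
apply: (hS _ _ (U ∘ pi1 ∘ pb2 t c ∘ q) (V ∘ pi2 ∘ pb2 t c ∘ q) (c ∘ pb2 t c ∘ q)).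
- by exists (pi1 ∘ pb2 t c ∘ q); rewrite !comp_assoc.
- by exists (pi2 ∘ pb2 t c ∘ q); rewrite !comp_assoc.
- exists (k ∘ pb2 t c ∘ q); rewrite !comp_assoc hk /=; split=> //.
  by rewrite /prod_mor !pair_comp.
- rewrite ez -pb_comm; exists (pb1 t c ∘ q); rewrite /m /t.
  by rewrite -[LHS]pair_eta !comp_assoc.
Qed.

Record Family {B : FinLimCat} (A : OPAS B) (X : B) := {
  fam_sub :> Sub (A ⊗ X);
  fam_down : down_closed fam_sub
}.

Definition tracks {B : FinLimCat} {A : OPAS B} {X X' : B} (U : Sub A)
    (Y : Family A X) (Y' : Family A X') (f : Hom X X') : Prop :=
  forall I (u a : Hom I A) (x : Hom I X), u ∈ U -> ⟨a, x⟩ ∈ Y ->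
    exists b, pm_val (app A) ⟨u, a⟩ b /\ ⟨b, f ∘ x⟩ ∈ Y'.

Definition trackable {B : FinLimCat} {A : OPAS B} (phi : Sub A -> Prop) {X X' : B}
    (Y : Family A X) (Y' : Family A X') (f : Hom X X') : Prop :=
  exists U, phi U /\ tracks U Y Y' f.

Lemma trackable_id (H : HeytingCat) (A : OPAS H) (phi : Sub A -> Prop)
    (hc : comb_complete phi) (X : H) (Y : Family A X) :
  trackable phi Y Y (idm X).
Proof.
have hp : pcf (A := A) (n := 1) (pm_total pi2) by do 2!constructor.
exists (realizers (n := 0) (pm_total (X := pow A 1) pi2)); split; first exact: hc hp.
move=> I u a x /realizersP [_ h2] hY.
case: (one_terminal I) => o _.
have ha : pm_val (pm_total (X := pow A 1) pi2) ⟨o, a⟩ a.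
  by apply/pm_total_val; rewrite pi2_pair.
case: (h2 _ (idm I) _ _ ha) => w [/iappS_val [r [/iapp0_val <- hw]] hle].
rewrite comp_idr in hw; exists w; split=> //.
by rewrite comp_idl; apply: fam_down hle hY.
Qed.

Lemma trackable_comp (H : HeytingCat) (A : OPAS H) (phi : Sub A -> Prop)
    (hf : external_filter phi) (hc : comb_complete phi) (X X' X'' : H)
    (Y : Family A X) (Y' : Family A X') (Y'' : Family A X'')
    (f : Hom X X') (g : Hom X' X'') :
  trackable phi Y Y' f -> trackable phi Y' Y'' g -> trackable phi Y Y'' (g ∘ f).
Proof.
move=> [U [hU tU]] [V [hV tV]].
pose pv : PMap (pow A 3) A := pm_total (pi2 ∘ pi1 ∘ pi1).
pose pu : PMap (pow A 3) A := pm_total (pi2 ∘ pi1).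
pose pa : PMap (pow A 3) A := pm_total pi2.
pose B := realizers (pm_app pv (pm_app pu pa)).
have hB : phi B by apply: hc; do 2?apply: pcf_app; repeat constructor.
have B1 : forall I (b v u : Hom I A), b ∈ B ->
    exists bv bvu, pm_val (app A) ⟨b, v⟩ bv /\ pm_val (app A) ⟨bv, u⟩ bvu.
  move=> I b v u /realizersP [h1 _]; case: (one_terminal I) => o _.
  case: (h1 _ (idm I) ⟨⟨o, v⟩, u⟩) => bvu /iappS_val [bv [/iappS_val [r []]]].
  by rewrite iapp0_val comp_idr => <- ? ?; exists bv, bvu.
have B2 : forall I (b v u a ua vua : Hom I A), b ∈ B ->
    pm_val (app A) ⟨u, a⟩ ua -> pm_val (app A) ⟨v, ua⟩ vua ->
    exists bv bvu bvua, pm_val (app A) ⟨b, v⟩ bv /\ pm_val (app A) ⟨bv, u⟩ bvu /\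
      pm_val (app A) ⟨bvu, a⟩ bvua /\ ⟨bvua, vua⟩ ∈ leq A.
  move=> I b v u a ua vua /realizersP [_ h2] hua hvua; case: (one_terminal I) => o _.
  have hv : pm_val (pm_app pv (pm_app pu pa)) ⟨⟨⟨o, v⟩, u⟩, a⟩ vua.
    apply/pm_app_val; exists v, ua; split; [|split=> //].
      by apply/pm_total_val; rewrite -!comp_assoc !pi1_pair pi2_pair.
    apply/pm_app_val; exists u, a; split; [|split=> //].
      by apply/pm_total_val; rewrite -!comp_assoc !pi1_pair pi2_pair.
    by apply/pm_total_val; rewrite pi2_pair.
  case: (h2 _ (idm I) _ _ hv) => w [/iappS_val [bvu [/iappS_val [bv [/iappS_val [r []]]]]]].
  by rewrite iapp0_val comp_idr => <- ? ? ? ?; exists bv, bvu, w.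
have hk : exists k, pm_dom (app A) ∘ k = sub_prod B V.
  have hb : B ∘ pi1 (Y := sub_ob V) ∈ B by exists pi1.
  case: (B1 _ _ (V ∘ pi2) (V ∘ pi2) hb) => bv [_ [h _]].
  by apply/pm_domP; exists bv.
case: hk => k hk; have hBV := filter_app hf hB hV hk.
have hl : exists l, pm_dom (app A) ∘ l = sub_prod (sub_app k) U.
  pose z : Hom (sub_ob (sub_app k) ⊗ sub_ob U) A := sub_app k ∘ pi1.
  apply: (sub_appE (z := z) hk); first by exists pi1.
  move=> J h b v w hb hv hw hzw.
  case: (B1 _ b v (U ∘ pi2 ∘ h) hb) => bv [bvu [hbv hbvu]].
  rewrite (pm_val_fun hw hbv) in hzw.
  case: (app_mono hzw (leq_refl (U ∘ pi2 ∘ h)) hbvu) => c [hc' _].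
  by rewrite /= /prod_mor pair_comp; apply/pm_domP; exists c.
case: hl => l hl; have hBVU := filter_app hf hBV hU hl.
exists (sub_app l); split=> // I c a x hcc hY.
have key : forall J (h : Hom J I) (z u w : Hom J A), z ∈ sub_app k -> u ∈ U ->
    pm_val (app A) ⟨z, u⟩ w -> ⟨c ∘ h, w⟩ ∈ leq A ->
    ⟨c ∘ h, a ∘ h⟩ ∈ pm_dom (app A) /\
    forall y, pm_val (app A) ⟨c ∘ h, a ∘ h⟩ y -> ⟨y, g ∘ f ∘ x ∘ h⟩ ∈ Y''.
  have loc : forall J (h : Hom J I) (z u w : Hom J A), z ∈ sub_app k -> u ∈ U ->
    pm_val (app A) ⟨z, u⟩ w -> ⟨c ∘ h, w⟩ ∈ leq A ->
    forall K (i : Hom K J) (b v zz : Hom K A), b ∈ B -> v ∈ V ->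
    pm_val (app A) ⟨b, v⟩ zz -> ⟨z ∘ i, zz⟩ ∈ leq A ->
    exists y, pm_val (app A) ⟨c ∘ h ∘ i, a ∘ h ∘ i⟩ y /\ ⟨y, g ∘ f ∘ x ∘ h ∘ i⟩ ∈ Y''.
    move=> J h z u w hz hu hw hcw K i b v zz hb hv hzz hle.
    have hYi : ⟨a ∘ h ∘ i, x ∘ h ∘ i⟩ ∈ Y.
      by rewrite -!pair_comp; do 2!apply: mem_comp.
    case: (tU _ (u ∘ i) _ _ (mem_comp _ hu) hYi) => ua [hua hY'].
    case: (tV _ v _ _ hv hY') => vua [hvua hY''].
    case: (B2 _ b v _ _ _ _ hb hua hvua) => bv [bvu [bvua [hbv [hbvu [hbvua hl3]]]]].
    rewrite (pm_val_fun hzz hbv) in hle.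
    case: (app_mono hle (leq_refl (u ∘ i)) hbvu) => w' [hw' hl2].
    have hwi := pm_val_comp i hw; rewrite pair_comp in hwi.
    rewrite (pm_val_fun hw' hwi) in hl2.
    have hl1 : ⟨c ∘ h ∘ i, w ∘ i⟩ ∈ leq A by rewrite -pair_comp; apply: mem_comp.
    case: (app_mono (leq_trans hl1 hl2) (leq_refl (a ∘ h ∘ i)) hbvua) => y [hy hly].
    exists y; split=> //.
    have := fam_down (leq_trans hly hl3) hY''; by rewrite !comp_assoc.
  move=> J h z u w hz hu hw hcw; split.
    apply: (sub_appE hk hz) => K i b v zz hb hv hzz hle.
    case: (loc _ _ _ _ _ hz hu hw hcw _ _ _ _ _ hb hv hzz hle) => y [hy _].
    by rewrite pair_comp; apply/pm_domP; exists y.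
  move=> y hy; apply: (sub_appE hk hz) => K i b v zz hb hv hzz hle.
  case: (loc _ _ _ _ _ hz hu hw hcw _ _ _ _ _ hb hv hzz hle) => y' [hy' hY''].
  have hyi := pm_val_comp i hy; rewrite pair_comp in hyi.
  by rewrite pair_comp (pm_val_fun hyi hy').
have : ⟨c, a⟩ ∈ pm_dom (app A).
  apply: (sub_appE hl hcc) => J h z u w hz hu hw hcw.
  by rewrite pair_comp; case: (key _ _ _ _ _ hz hu hw hcw).
move=> /pm_domP [y hy]; exists y; split=> //.
apply: (sub_appE hl hcc) => J h z u w hz hu hw hcw.
case: (key _ _ _ _ _ hz hu hw hcw) => _ /(_ (y ∘ h)).
have := pm_val_comp h hy; rewrite !pair_comp => h1 /(_ h1).
by [].
Qed.

Definition realizability_cat {H : HeytingCat} {A : OPAS H} {phi : Sub A -> Prop}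
    (hf : external_filter phi) (hc : comb_complete phi) : Cat.
Proof.
refine {|
  Ob := {X : H & Family A X};
  Hom := fun Y Y' => {f : Hom (projT1 Y) (projT1 Y') |
                      trackable phi (projT2 Y) (projT2 Y') f};
  idm := fun Y => exist _ (idm (projT1 Y)) (trackable_id hc (projT2 Y));
  comp := fun Y Y' Y'' g f =>
    exist _ (proj1_sig g ∘ proj1_sig f)
      (trackable_comp hf hc (proj2_sig f) (proj2_sig g))
|}.
- by move=> X Y [f hY]; apply: subset_eq_compat; apply: comp_idl.
- by move=> X Y [f hY]; apply: subset_eq_compat; apply: comp_idr.
- by move=> X Y Z W f g h; apply: subset_eq_compat; apply: comp_assoc.
Defined.

Definition realizability_fibration {H : HeytingCat} {A : OPAS H} {phi : Sub A -> Prop}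
    (hf : external_filter phi) (hc : comb_complete phi) :
    Functor (realizability_cat hf hc) H :=
  {| fob := fun Y : realizability_cat hf hc => projT1 Y;
     fmor := fun (Y Y' : realizability_cat hf hc) (f : Hom Y Y') => proj1_sig f;
     fmor_id := fun Y => eq_refl;
     fmor_comp := fun Y Y' Y'' f g => eq_refl |}.

(** The identity arrow seen as an arrow between two equal objects; it is used to
    state strict equalities such as [F E = X] on arrows. *)
Definition eq_hom {B : Cat} {X Y : B} (e : X = Y) : Hom X Y :=
  match e in _ = Y return Hom X Y with eq_refl => idm X end.

Definition prone {E B : Cat} (F : Functor E B) {X Y : E} (f : Hom X Y) : Prop :=
  forall (X' : E) (g : Hom X' Y) (h : Hom (F X') (F X)),
    fmor F g = fmor F f ∘ h -> exists! k : Hom X' X, g = f ∘ k /\ fmor F k = h.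

Definition supine {E B : Cat} (F : Functor E B) {X Y : E} (f : Hom X Y) : Prop :=
  prone (op_functor F) (X := Y) (Y := X) f.

Record Over {E B : Cat} (F : Functor E B) (X : B) := {
  ov_ob :> E;
  ov_eq : F ov_ob = X
}.

Definition lies_over {E B : Cat} {F : Functor E B} {X Y : B} (u : Hom X Y)
    (P : Over F X) (Q : Over F Y) (f : Hom P Q) : Prop :=
  eq_hom (ov_eq Q) ∘ fmor F f = u ∘ eq_hom (ov_eq P).

Arguments lies_over {E B F X Y} u {P Q} f.

Definition is_fibration {E B : Cat} (F : Functor E B) : Prop :=
  forall (X : E) (Y : B) (u : Hom Y (F X)),
    exists (P : Over F Y) (f : Hom P X), prone F f /\ fmor F f = u ∘ eq_hom (ov_eq P).

Definition is_bifibration {E B : Cat} (F : Functor E B) : Prop :=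
  is_fibration F /\ is_fibration (op_functor F).

(** The order of the fibres: existence of a vertical arrow. *)
Definition fib_le {E B : Cat} {F : Functor E B} {X : B} (P Q : Over F X) : Prop :=
  exists f : Hom P Q, lies_over (idm X) f.
Definition fib_eq {E B : Cat} {F : Functor E B} {X : B} (P Q : Over F X) : Prop :=
  fib_le P Q /\ fib_le Q P.

(** [P ≃ F_u Q] and [Q ≃ ∃_u P]. Reindexing and coindexing are only determined up
    to isomorphism in the fibres, and are used as relations. *)
Definition is_reindex {E B : Cat} {F : Functor E B} {X Y : B} (u : Hom X Y)
    (P : Over F X) (Q : Over F Y) : Prop :=
  exists f : Hom P Q, lies_over u f /\ prone F f.
Definition is_coindex {E B : Cat} {F : Functor E B} {X Y : B} (u : Hom X Y)
    (P : Over F X) (Q : Over F Y) : Prop :=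
  exists f : Hom P Q, lies_over u f /\ supine F f.

Definition is_top {E B : Cat} {F : Functor E B} {X : B} (T : Over F X) : Prop :=
  forall P : Over F X, fib_le P T.
Definition is_meet {E B : Cat} {F : Functor E B} {X : B} (P Q M : Over F X) : Prop :=
  forall R : Over F X, fib_le R M <-> fib_le R P /\ fib_le R Q.

Definition fib_products {E B : Cat} (F : Functor E B) : Prop :=
  forall X : B, (exists T : Over F X, is_top T) /\
    forall P Q : Over F X, exists M, is_meet P Q M.

Definition reindex_products {E B : Cat} (F : Functor E B) : Prop :=
  forall (X Y : B) (u : Hom X Y),
    (forall (T : Over F Y) (T' : Over F X), is_top T -> is_reindex u T' T -> is_top T') /\
    (forall (P Q M : Over F Y) (P' Q' M' : Over F X), is_meet P Q M ->
       is_reindex u P' P -> is_reindex u Q' Q -> is_reindex u M' M -> is_meet P' Q' M').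

(** [F_f (∃_h P) ≃ ∃_g (F_k P)] for a pullback square [f ∘ g = h ∘ k]. *)
Definition beck_chevalley {E B : Cat} (F : Functor E B) : Prop :=
  forall (W X Y Z : B) (f : Hom X Z) (g : Hom W X) (h : Hom Y Z) (k : Hom W Y),
    is_pullback f h g k ->
    forall (P : Over F Y) (hP : Over F Z) (fhP : Over F X)
           (kP : Over F W) (gkP : Over F X),
      is_coindex h P hP -> is_reindex f fhP hP ->
      is_reindex k kP P -> is_coindex g kP gkP -> fib_eq fhP gkP.

(** [∃_f (P ∧ F_f Q) ≃ ∃_f P ∧ Q]. *)
Definition frobenius {E B : Cat} (F : Functor E B) : Prop :=
  forall (X Y : B) (f : Hom X Y) (P fQ PfQ : Over F X) (Q fP L R : Over F Y),
    is_reindex f fQ Q -> is_meet P fQ PfQ -> is_coindex f PfQ L ->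
    is_coindex f P fP -> is_meet fP Q R -> fib_eq L R.

Record fibred_locale {E : Cat} {B : FinLimCat} (F : Functor E B) : Prop := {
  fl_faithful : faithful F;
  fl_bifibration : is_bifibration F;
  fl_products : fib_products F;
  fl_reindex_products : reindex_products F;
  fl_beck_chevalley : beck_chevalley F;
  fl_frobenius : frobenius F
}.

Definition separated {E B : Cat} (F : Functor E B) : Prop :=
  forall (X Y : B) (e : Hom X Y), regular_epi e ->
    forall (T : Over F X) (T' : Over F Y), is_top T -> is_coindex e T T' -> is_top T'.

Definition functor_id (E : Cat) : Functor E E :=
  {| fob := fun X : E => X; fmor := fun X Y f => f;
     fmor_id := fun X => eq_refl; fmor_comp := fun X Y Z f g => eq_refl |}.

Lemma fmor_id_comp (D E B : Cat) (G : Functor D E) (K : Functor E B) (X : D) :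
  fmor K (fmor G (idm X)) = idm (K (G X)).
Proof. by rewrite !fmor_id. Qed.

Lemma fmor_comp_comp (D E B : Cat) (G : Functor D E) (K : Functor E B) (X Y Z : D)
    (f : Hom X Y) (g : Hom Y Z) :
  fmor K (fmor G (g ∘ f)) = fmor K (fmor G g) ∘ fmor K (fmor G f).
Proof. by rewrite !fmor_comp. Qed.

Definition functor_comp (D E B : Cat) (K : Functor E B) (G : Functor D E) : Functor D B :=
  {| fob := fun X : D => K (G X); fmor := fun X Y f => fmor K (fmor G f);
     fmor_id := @fmor_id_comp D E B G K; fmor_comp := @fmor_comp_comp D E B G K |}.

Definition functor_eq {E B : Cat} (F G : Functor E B) : Prop :=
  exists e : forall X, F X = G X,
    forall X Y (f : Hom X Y), eq_hom (e Y) ∘ fmor F f = fmor G f ∘ eq_hom (e X).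

Definition fibred_functor {D E B : Cat} (P : Functor D B) (Q : Functor E B)
    (G : Functor D E) : Prop :=
  functor_eq (functor_comp Q G) P /\
  forall (X Y : D) (f : Hom X Y), prone P f -> prone Q (fmor G f).

Definition vertical_nat_iso {D E B : Cat} (Q : Functor E B) (G K : Functor D E) : Prop :=
  exists eta : forall X : D, Hom (G X) (K X),
    (forall X Y (f : Hom X Y), eta Y ∘ fmor G f = fmor K f ∘ eta X) /\
    forall X, iso (eta X) /\
      exists e : Q (G X) = Q (K X), fmor Q (eta X) = eq_hom e.

Definition fibred_equivalent {D E B : Cat} (P : Functor D B) (Q : Functor E B) : Prop :=
  exists (G : Functor D E) (K : Functor E D),
    fibred_functor P Q G /\ fibred_functor Q P K /\
    vertical_nat_iso P (functor_comp K G) (functor_id D) /\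
    vertical_nat_iso Q (functor_comp G K) (functor_id E).

Definition vertical_filter {E : Cat} {B : FinLimCat} {F : Functor E B} {A : OPAS B}
    (C : Over F A) : Prop :=
  (forall sC tC : Over F (sub_ob (leq A)),
     is_reindex (pi1 ∘ leq A) sC C -> is_reindex (pi2 ∘ leq A) tC C -> fib_le sC tC) /\
  (forall pC qC pqC aC : Over F (sub_ob (pm_dom (app A))),
     is_reindex (pi1 ∘ pm_dom (app A)) pC C -> is_reindex (pi2 ∘ pm_dom (app A)) qC C ->
     is_meet pC qC pqC -> is_reindex (pm_map (app A)) aC C -> fib_le pqC aC).

Definition weakly_generic {E B : Cat} (F : Functor E B) (C : E) : Prop :=
  forall X : E, exists (Y : E) (p : Hom Y C) (s : Hom Y X), prone F p /\ supine F s.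

(** A prodo morphism [pr_map] into [X], together with the [C]-component [pr_real] of
    the prone monomorphism into [C × X]. *)
Record Prodo {E : Cat} {B : FinLimCat} {F : Functor E B} {A : OPAS B}
    (C : Over F A) (X : E) := {
  pr_ob : E;
  pr_real : Hom pr_ob C;
  pr_map : Hom pr_ob X;
  pr_prone_mono : exists (P : E) (p : Hom P C) (q : Hom P X) (m : Hom pr_ob P),
    is_product p q /\ mono m /\ prone F m /\ p ∘ m = pr_real /\ q ∘ m = pr_map;
  pr_down : down_closed ⟨eq_hom (ov_eq C) ∘ fmor F pr_real, fmor F pr_map⟩
}.

(** [(a, b, z) ↦ (ab, b, z)] is expressed on the pullback [Q = W ×_Z Y]: [a] and [b]
    are the [A]-components of [FQ → FW] and [FQ → FY]. *)
Definition church_rule {E : Cat} {B : FinLimCat} {F : Functor E B} {A : OPAS B}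
    (C : Over F A) : Prop :=
  forall (Z : E) (g : Prodo C Z) (f : Prodo C (pr_ob g)), supine F (pr_map f) ->
  exists e : Prodo C Z, supine F (pr_map e) /\
    forall (Q : E) (q1 : Hom Q (pr_ob e)) (q2 : Hom Q (pr_ob g)),
      is_pullback (pr_map e) (pr_map g) q1 q2 ->
      exists k : Hom Q (pr_ob f), pr_map f ∘ k = q2 /\
        pm_val (app A)
          ⟨eq_hom (ov_eq C) ∘ fmor F (pr_real e ∘ q1),
           eq_hom (ov_eq C) ∘ fmor F (pr_real g ∘ q2)⟩
          (eq_hom (ov_eq C) ∘ fmor F (pr_real f ∘ k)).

(** The arrow [k] expresses [W ×_Z Y ⊆ X] as subobjects of [C × Y]. *)
Definition uniformity_rule {E : Cat} {B : FinLimCat} {F : Functor E B} {A : OPAS B}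
    (C : Over F A) : Prop :=
  forall (Y Z : E) (f : Prodo C Y) (g : Hom Y Z), supine F (pr_map f) -> prone F g ->
  exists e : Prodo C Z, supine F (pr_map e) /\
    forall (Q : E) (q1 : Hom Q (pr_ob e)) (q2 : Hom Q Y),
      is_pullback (pr_map e) g q1 q2 ->
      exists k : Hom Q (pr_ob f), pr_map f ∘ k = q2 /\ pr_real f ∘ k = pr_real e ∘ q1.

Definition represents {E : Cat} {B : FinLimCat} {F : Functor E B} {A : OPAS B}
    (C : Over F A) (phi : Sub A -> Prop) : Prop :=
  forall U : Sub A, downset U ->
  forall (CU : Over F (sub_ob U)), is_reindex U CU C ->
  forall (T : E) (t : Hom CU T), is_terminal T -> (supine F t <-> phi U).

(* Main.v *)
From Corelib Require Import ssreflect.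
From Stdlib Require Import IndefiniteDescription ProofIrrelevance.
Require Import Defs.

(** A family of downsets [Y ⊆ A × X] is sent to [∃_{Y → X} C_Y]. Every object of [F]
    arises in this way: close the image in [A × X] of a weakly generic span
    [C ← P → X] downward; [C] being a vertical filter and [F] separated, this does
    not change the coindexed object. If [U ∈ φ] tracks [f : Y → Y'], then
    [C_U → 1] is supine, so [C_Y] is covered by [C_U × C_Y], which application maps
    to [C_Y']. Conversely, given [∃ C_Y ≤ F_f (∃ C_Y')], the object
    [{(b, a, x) | (a, x) ∈ Y, (b, f x) ∈ Y'}] is supine over [C_Y]; as [C_Y → C] is
    prone, the uniformity rule makes the choice of [b] depend on [a] only, and
    Church's rule for the prodo morphisms into [C → 1] gives a realizer
    [u] with [u a = b]. *)

Set Implicit Arguments.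
Unset Strict Implicit.
Unset Printing Implicit Defensive.
Local Open Scope cat_scope.

(** * Transport along equalities of objects *)

Lemma eq_hom_symr (B : Cat) (X Y : B) (e : X = Y) : eq_hom e ∘ eq_hom (eq_sym e) = idm Y.
Proof. by case: Y / e; apply: comp_idl. Qed.

Lemma eq_hom_syml (B : Cat) (X Y : B) (e : X = Y) : eq_hom (eq_sym e) ∘ eq_hom e = idm X.
Proof. by case: Y / e; apply: comp_idl. Qed.

Lemma mem_eq_hom (B : Cat) (I X M N : B) (x : Hom I X) (m : Hom N X) (e : M = N) :
  x ∈ m ∘ eq_hom e <-> x ∈ m.
Proof. by case: N / e m => m; rewrite comp_idr. Qed.

Definition reify {E B : Cat} {F : Functor E B} (P : E) : Over F (F P) :=
  {| ov_ob := P; ov_eq := eq_refl |}.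

(** [mor u P Q] is [P ≤ F_u Q]; over a faithful functor an arrow is no more
    than a base arrow satisfying [mor]. *)
Definition mor {E B : Cat} {F : Functor E B} {X Y : B} (u : Hom X Y)
    (P : Over F X) (Q : Over F Y) : Prop :=
  exists f : Hom P Q, lies_over u f.

(** * Calculus of arrows lying over base arrows *)

Section Mor.
Variables (E B : Cat) (F : Functor E B).

Lemma mor_id (X : B) (P : Over F X) : mor (idm X) P P.
Proof. by exists (idm _); rewrite /lies_over fmor_id comp_idl comp_idr. Qed.

Lemma mor_eq (X Y : B) (u v : Hom X Y) (P : Over F X) (Q : Over F Y) :
  mor u P Q -> u = v -> mor v P Q.
Proof. by move=> h <-. Qed.

Lemma mor_comp (X Y Z : B) (u : Hom X Y) (v : Hom Y Z) (P : Over F X) (Q : Over F Y)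
    (R : Over F Z) : mor u P Q -> mor v Q R -> mor (v ∘ u) P R.
Proof.
move=> [f hf] [g hg]; exists (g ∘ f).
by rewrite /lies_over fmor_comp comp_assoc hg -comp_assoc hf comp_assoc.
Qed.

Lemma mor_le (X Y : B) (u : Hom X Y) (P : Over F X) (Q Q' : Over F Y) :
  mor u P Q -> fib_le Q Q' -> mor u P Q'.
Proof. by move=> h1 h2; rewrite -(comp_idl u); apply: mor_comp h1 h2. Qed.

Lemma le_mor (X Y : B) (u : Hom X Y) (P P' : Over F X) (Q : Over F Y) :
  fib_le P P' -> mor u P' Q -> mor u P Q.
Proof. by move=> h1 h2; rewrite -(comp_idr u); apply: mor_comp h1 h2. Qed.

Lemma mor_fmor (P Q : E) (f : Hom P Q) : mor (fmor F f) (reify (F := F) P) (reify Q).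
Proof. by exists f; rewrite /lies_over /= comp_idl comp_idr. Qed.

Lemma mor_reify (P Q : E) (u : Hom (F P) (F Q)) :
  mor u (reify P) (reify Q) <-> exists f : Hom P Q, fmor F f = u.
Proof.
by split=> -[f]; rewrite /lies_over /= => h; exists f; move: h;
   rewrite ?/lies_over /= comp_idl comp_idr.
Qed.

Lemma reify_over (X : B) (P : Over F X) : mor (eq_hom (ov_eq P)) (reify P) P.
Proof. by exists (idm _); rewrite /lies_over fmor_id. Qed.

Hypothesis hf : faithful F.

(** As [F] is faithful, the equation and the uniqueness in the definition of [prone] come for free;
    only the existence of an arrow over [v] is left. *)
Lemma reindexP (X Y : B) (u : Hom X Y) (P : Over F X) (Q : Over F Y) :
  is_reindex u P Q <->
  mor u P Q /\ forall Z (v : Hom Z X) (R : Over F Z), mor (u ∘ v) R Q -> mor v R P.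
Proof.
case: P => P eP; case: Q => Q eQ; subst X Y; split.
  move=> [f []]; rewrite /lies_over /= comp_idl comp_idr => <- hp; split.
    exact: mor_fmor.
  move=> Z v [R eR]; subst Z => -[g]; rewrite /lies_over /= comp_idl comp_idr => hg.
  case: (hp _ g v hg) => k [[_ hk] _]; exists k.
  by rewrite /lies_over /= comp_idl comp_idr.
move=> [[f hu] h]; exists f; split=> // Z g v e.
move: hu; rewrite /lies_over /= comp_idl comp_idr => hu.
case: (h _ v (reify Z)); first by exists g; rewrite /lies_over /= comp_idl comp_idr e hu.
move=> k; rewrite /lies_over /= comp_idl comp_idr => hk.
exists k; split; first by split=> //; apply: hf; rewrite fmor_comp hk.
by move=> k' [_ hk']; apply: hf; rewrite hk hk'.
Qed.

Lemma coindexP (X Y : B) (u : Hom X Y) (P : Over F X) (Q : Over F Y) :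
  is_coindex u P Q <->
  mor u P Q /\ forall Z (v : Hom Y Z) (R : Over F Z), mor (v ∘ u) P R -> mor v Q R.
Proof.
case: P => P eP; case: Q => Q eQ; subst X Y; split.
  move=> [f []]; rewrite /lies_over /= comp_idl comp_idr => <- hp; split.
    exact: mor_fmor.
  move=> Z v [R eR]; subst Z => -[g]; rewrite /lies_over /= comp_idl comp_idr => hg.
  case: (hp _ g v hg) => k [[_ hk] _]; exists k.
  by rewrite /lies_over /= comp_idl comp_idr.
move=> [[f hu] h]; exists f; split=> // Z g v e.
move: hu; rewrite /lies_over /= comp_idl comp_idr => hu.
case: (h _ v (reify (F := F) Z)).
  exists g; rewrite /lies_over /= comp_idl comp_idr.
  by rewrite /= hu in e.
move=> k; rewrite /lies_over /= comp_idl comp_idr => hk.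
exists k; split; first by split=> //; apply: hf; rewrite /= fmor_comp hk.
by move=> k' [_ hk']; apply: hf; rewrite hk -hk'.
Qed.

Lemma proneP (P Q : E) (f : Hom P Q) :
  prone F f <-> forall Z (v : Hom Z (F P)) (R : Over F Z),
    mor (fmor F f ∘ v) R (reify Q) -> mor v R (reify P).
Proof.
have e : prone F f <-> is_reindex (fmor F f) (reify P) (reify Q).
  split=> [h|[g []]].
    by exists f; split=> //; rewrite /lies_over /= comp_idl comp_idr.
  by rewrite /lies_over /= comp_idl comp_idr => /hf ->.
by rewrite e reindexP; split=> [[]|h] //; split=> //; apply: mor_fmor.
Qed.

Lemma supineP (P Q : E) (f : Hom P Q) :
  supine F f <-> forall Z (v : Hom (F Q) Z) (R : Over F Z),
    mor (v ∘ fmor F f) (reify P) R -> mor v (reify Q) R.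
Proof.
have e : supine F f <-> is_coindex (fmor F f) (reify P) (reify Q).
  split=> [h|[g []]].
    by exists f; split=> //; rewrite /lies_over /= comp_idl comp_idr.
  by rewrite /lies_over /= comp_idl comp_idr => /hf ->.
by rewrite e coindexP; split=> [[]|h] //; split=> //; apply: mor_fmor.
Qed.

Lemma lies_over_exists (X Y : B) (P : Over F X) (Q : Over F Y) (f : Hom P Q) :
  exists u, lies_over u f.
Proof.
case: P f => P eP; case: Q => Q eQ; subst X Y => /= f.
by exists (fmor F f); rewrite /lies_over /= comp_idl comp_idr.
Qed.

Lemma lies_over_unique (X Y : B) (P : Over F X) (Q : Over F Y) (f : Hom P Q) u v :
  lies_over u f -> lies_over v f -> u = v.
Proof.
case: P f => P eP; case: Q => Q eQ; subst X Y => /= f.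
by rewrite /lies_over /= !comp_idr => <- <-.
Qed.

Lemma lies_over_inj (X Y : B) (P : Over F X) (Q : Over F Y) (f g : Hom P Q) u :
  lies_over u f -> lies_over u g -> f = g.
Proof.
case: P f g => P eP; case: Q => Q eQ; subst X Y => /= f g.
by rewrite /lies_over /= !comp_idl !comp_idr => e1 e2; apply: hf; rewrite e1 e2.
Qed.

Lemma lies_over_comp (X Y Z : B) (P : Over F X) (Q : Over F Y) (R : Over F Z)
    (f : Hom P Q) (g : Hom Q R) u v :
  lies_over u f -> lies_over v g -> lies_over (v ∘ u) (g ∘ f).
Proof.
move=> h1 h2; rewrite /lies_over fmor_comp comp_assoc h2 -comp_assoc h1.
by rewrite comp_assoc.
Qed.

Lemma mor_to_reify (X Z : B) (P : Over F X) (v : Hom Z (F P)) (R : Over F Z) :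
  mor v R (reify P) <-> mor (eq_hom (ov_eq P) ∘ v) R P.
Proof. by case: P v => P eP; subst X => v /=; rewrite comp_idl. Qed.

Lemma mor_from_reify (X Z : B) (v : Hom X Z) (R : Over F Z) (P : Over F X) :
  mor (v ∘ eq_hom (ov_eq P)) (reify P) R <-> mor v P R.
Proof. by case: P => P eP; subst X => /=; rewrite comp_idr. Qed.

End Mor.

(** * Fibrewise operations and finite limits in a fibred locale *)

Section FibredLocale.
Variables (E : Cat) (B : FinLimCat) (F : Functor E B).
Hypothesis hF : fibred_locale F.
Let hf : faithful F := fl_faithful hF.

Lemma reindex_exists (X Y : B) (u : Hom X Y) (Q : Over F Y) : exists P, is_reindex u P Q.
Proof.
case: Q => Q eQ; subst Y.
case: (proj1 (fl_bifibration hF) Q X u) => P [f [hp e]].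
exists P, f; split=> //; by rewrite /lies_over /= comp_idl.
Qed.

Lemma coindex_exists (X Y : B) (u : Hom X Y) (P : Over F X) : exists Q, is_coindex u P Q.
Proof.
case: P => P eP; subst X.
case: (proj2 (fl_bifibration hF) P Y u) => -[Q eQ] [f [hp e]].
subst Y; exists (reify (F := F) Q), f; split=> //.
by move: e; rewrite /lies_over /= comp_idl !comp_idr => ->; rewrite comp_idl.
Qed.

(** Reindexing, coindexing, tops and meets are unique only up to vertical isomorphism; fixing
    choices turns their universal properties into equivalences between [mor] statements. *)
Definition reix (X Y : B) (u : Hom X Y) (Q : Over F Y) : Over F X :=
  proj1_sig (constructive_indefinite_description _ (reindex_exists u Q)).
Definition coix (X Y : B) (u : Hom X Y) (P : Over F X) : Over F Y :=
  proj1_sig (constructive_indefinite_description _ (coindex_exists u P)).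
Definition top (X : B) : Over F X :=
  proj1_sig (constructive_indefinite_description _ (proj1 (fl_products hF X))).
Definition meet (X : B) (P Q : Over F X) : Over F X :=
  proj1_sig (constructive_indefinite_description _ (proj2 (fl_products hF X) P Q)).

Lemma reix_is (X Y : B) (u : Hom X Y) (Q : Over F Y) : is_reindex u (reix u Q) Q.
Proof. by rewrite /reix; case: constructive_indefinite_description. Qed.

Lemma coix_is (X Y : B) (u : Hom X Y) (P : Over F X) : is_coindex u P (coix u P).
Proof. by rewrite /coix; case: constructive_indefinite_description. Qed.

Lemma meet_is (X : B) (P Q : Over F X) : is_meet P Q (meet P Q).
Proof. by rewrite /meet; case: constructive_indefinite_description. Qed.

Lemma top_is (X : B) : is_top (top X).
Proof. by rewrite /top; case: constructive_indefinite_description. Qed.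

Lemma mor_reix (X Y Z : B) (u : Hom X Y) (v : Hom Z X) (R : Over F Z) (Q : Over F Y) :
  mor v R (reix u Q) <-> mor (u ∘ v) R Q.
Proof.
case/(reindexP hf): (reix_is u Q) => h1 h2; split; last exact: h2.
by move=> h; apply: mor_comp h h1.
Qed.

Lemma coix_mor (X Y Z : B) (u : Hom X Y) (v : Hom Y Z) (P : Over F X) (R : Over F Z) :
  mor v (coix u P) R <-> mor (v ∘ u) P R.
Proof.
case/(coindexP hf): (coix_is u P) => h1 h2; split; last exact: h2.
by move=> h; apply: mor_comp h1 h.
Qed.

Lemma reix_le (X Y : B) (u : Hom X Y) (P : Over F X) (Q : Over F Y) :
  fib_le P (reix u Q) <-> mor u P Q.
Proof. by rewrite -{2}(comp_idr u); apply: mor_reix. Qed.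

Lemma mor_coix_id (X Y : B) (u : Hom X Y) (P : Over F X) : mor u P (coix u P).
Proof. by rewrite -(comp_idl u); apply/coix_mor; rewrite comp_idl; apply: mor_id. Qed.

(** Reindexing preserves meets, so the universal property of a meet within its fibre extends to
    arrows over any [v]. *)
Lemma mor_meet (X Z : B) (v : Hom Z X) (R : Over F Z) (P Q : Over F X) :
  mor v R (meet P Q) <-> mor v R P /\ mor v R Q.
Proof.
case: (proj2 (fl_reindex_products hF v) _ _ _ _ _ _ (meet_is P Q)
  (reix_is v P) (reix_is v Q) (reix_is v (meet P Q)) R) => h1 h2.
by rewrite -!reix_le; split=> [/h1|/h2].
Qed.

Lemma meet_l (X : B) (P Q : Over F X) : fib_le (meet P Q) P.
Proof. by case: (proj1 (mor_meet (idm X) (meet P Q) P Q)); first exact: mor_id. Qed.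

Lemma meet_r (X : B) (P Q : Over F X) : fib_le (meet P Q) Q.
Proof. by case: (proj1 (mor_meet (idm X) (meet P Q) P Q)); first exact: mor_id. Qed.

Lemma mor_top (X Z : B) (v : Hom Z X) (R : Over F Z) : mor v R (top X).
Proof.
apply/reix_le.
exact: (proj1 (fl_reindex_products hF v) _ _ (@top_is X) (reix_is v (top X)) R).
Qed.

(** Combines Beck-Chevalley and Frobenius: any [z : ∃_u P] may be assumed to come
    from [P], up to change of stage. *)
Lemma mor_cover (X Y Z W : B) (u : Hom X Y) (v : Hom Z Y) (w : Hom Z W)
    (P : Over F X) (R : Over F Z) (Q : Over F W) :
  mor v R (coix u P) ->
  (forall J (h : Hom J Z) (k : Hom J X) (S : Over F J), v ∘ h = u ∘ k ->
     mor h S R -> mor k S P -> mor (w ∘ h) S Q) ->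
  mor w R Q.
Proof.
set p := pb1 v u; set q := pb2 v u => hR hl.
have /coix_mor hQ : mor (w ∘ p) (meet (reix p R) (reix q P)) Q.
  apply: (hl _ _ q); first exact: pb_comm.
    by apply/reix_le; apply: meet_l.
  by apply/reix_le; apply: meet_r.
(* By Beck-Chevalley, [F_v (∃_u P) ≃ ∃_p (F_q P)]; by Frobenius,
   [∃_p (F_q P ∧ F_p R) ≃ ∃_p (F_q P) ∧ R], and [R] lies below both factors on the right. *)
have bc := fl_beck_chevalley hF (pb_pullback v u) (coix_is u P)
  (reix_is v (coix u P)) (reix_is q P) (coix_is p (reix q P)).
have fr := fl_frobenius hF (reix_is p R) (meet_is _ _) (coix_is _ _)
  (coix_is p (reix q P)) (meet_is _ _).
apply: le_mor hQ.
have h : fib_le R (meet (coix p (reix q P)) R).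
  apply/mor_meet; split; last exact: mor_id.
  by apply: mor_le (proj1 bc); apply/reix_le.
have {}h := mor_le h (proj2 fr).
apply: (mor_le h); apply/coix_mor; rewrite comp_idl.
apply: (le_mor _ (mor_coix_id _ _)).
by apply/mor_meet; split; [apply: meet_r|apply: meet_l].
Qed.

Lemma top_terminal : is_terminal (ov_ob (top one)).
Proof.
move=> X; case: (one_terminal (F X)) => o [_ ho].
case: (mor_top o (reify X)) => f; rewrite /lies_over /= comp_idr => hfo.
exists f; split=> // g _; apply: hf.
have hinj : forall x y : Hom (F X) (F (top one)), x = y.
  move=> x y; case: (top one) x y => T eT /=; move: (eT) => eT'.
  rewrite eT => x y; by rewrite -(ho x) // -(ho y).
exact: hinj.
Qed.

(** By [mor_meet] and [mor_reix], an arrow into this meet over [⟨u, v⟩] amounts to a pair of arrows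
    over [u] and [v]. *)
Lemma product_over (X Y : B) (P : Over F X) (Q : Over F Y) :
  exists (p : Hom (meet (reix pi1 P) (reix pi2 Q)) P)
         (q : Hom (meet (reix pi1 P) (reix pi2 Q)) Q),
    lies_over pi1 p /\ lies_over pi2 q /\ is_product p q.
Proof.
set M := meet _ _.
have [p hp] : mor pi1 M P by apply/reix_le; apply: meet_l.
have [q hq] : mor pi2 M Q by apply/reix_le; apply: meet_r.
exists p, q; do 2!split=> //; move=> I x y.
case: (lies_over_exists (P := reify (F := F) I) x) => u hu.
case: (lies_over_exists (P := reify (F := F) I) y) => v hv.
have [k hk] : mor ⟨u, v⟩ (reify I) M.
  apply/mor_meet; rewrite !mor_reix pi1_pair pi2_pair.
  by split; [exists x|exists y].
exists k; split.
  split.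
    by apply: (lies_over_inj hf (lies_over_comp hk hp)); rewrite pi1_pair.
  by apply: (lies_over_inj hf (lies_over_comp hk hq)); rewrite pi2_pair.
move=> k' [e1 e2]; case: (lies_over_exists (P := reify (F := F) I) k') => w hw.
apply: (lies_over_inj hf hk); suff -> : ⟨u, v⟩ = w by [].
have := lies_over_comp hw hp; rewrite e1 => /(lies_over_unique hu) ->.
have := lies_over_comp hw hq; rewrite e2 => /(lies_over_unique hv) ->.
exact: pair_eta.
Qed.

Lemma pullback_over (P Q Z : E) (f : Hom P Z) (g : Hom Q Z) :
  exists (M : Over F (pb (fmor F f) (fmor F g))) (p : Hom M P) (q : Hom M Q),
    lies_over (Q := reify P) (pb1 (fmor F f) (fmor F g)) p /\
    lies_over (Q := reify Q) (pb2 (fmor F f) (fmor F g)) q /\ is_pullback f g p q.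
Proof.
set s := pb1 _ _; set t := pb2 _ _.
pose M := meet (reix s (reify P)) (reix t (reify Q)); exists M.
have [p hp] : mor s M (reify P) by apply/reix_le; apply: meet_l.
have [q hq] : mor t M (reify Q) by apply/reix_le; apply: meet_r.
have lo : forall P' Q' (h : Hom P' Q'), lies_over (P := reify P') (Q := reify Q') (fmor F h) h.
  by move=> P' Q' h; rewrite /lies_over /= comp_idl comp_idr.
exists p, q; do 2!split=> //; split.
  have h1 := lies_over_comp hp (lo _ _ f); have h2 := lies_over_comp hq (lo _ _ g).
  by rewrite pb_comm in h1; exact: (lies_over_inj hf h1 h2).
move=> I x y exy.
have [|i [i1 i2]] := pb_lift (f := fmor F f) (g := fmor F g) (x := fmor F x) (y := fmor F y).
  by rewrite -!fmor_comp exy.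
have [k hk] : mor i (reify I) M.
  by apply/mor_meet; rewrite !mor_reix i1 i2; split; apply: mor_fmor.
exists k; split.
  split.
    by apply: (lies_over_inj hf (lies_over_comp hk hp)); rewrite -/s i1; apply: lo.
  by apply: (lies_over_inj hf (lies_over_comp hk hq)); rewrite -/t i2; apply: lo.
move=> k' [e1 e2]; case: (lies_over_exists (P := reify (F := F) I) k') => w hw.
apply: (lies_over_inj hf hk); suff -> : i = w by [].
apply: pb_joint_mono; rewrite ?i1 ?i2.
  by have := lies_over_comp hw hp; rewrite e1 => /(lies_over_unique (lo _ _ x)).
by have := lies_over_comp hw hq; rewrite e2 => /(lies_over_unique (lo _ _ y)).
Qed.

(** Church's rule and the uniformity rule give arrows out of pullbacks in [E]; this pullback lies
    over one of the base, so the arrows can be evaluated at compatible pairs of base elements. *)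
Lemma pullback_point (P Q Z : E) (f : Hom P Z) (g : Hom Q Z) :
  exists (M : E) (p : Hom M P) (q : Hom M Q), is_pullback f g p q /\
    forall I (x : Hom I (F P)) (y : Hom I (F Q)), fmor F f ∘ x = fmor F g ∘ y ->
      exists i, fmor F p ∘ i = x /\ fmor F q ∘ i = y.
Proof.
case: (pullback_over f g) => M [p [q [hp [hq h]]]].
exists (ov_ob M), p, q; split=> // I x y e.
case: (pb_lift e) => i [<- <-].
move: hp hq; rewrite /lies_over /= !comp_idl => -> ->.
exists (eq_hom (eq_sym (ov_eq M)) ∘ i).
by rewrite -!comp_assoc (comp_assoc i (eq_hom (eq_sym (ov_eq M)))) eq_hom_symr comp_idl.
Qed.

End FibredLocale.

(** * Covers and regular epimorphisms in a Heyting category *)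

Section Covers.
Variable H : HeytingCat.

(** Equality of [x] and [y] is membership of [⟨x, y⟩] in the diagonal, and membership is local along
    covers. *)
Lemma cover_epi (I J X : H) (e : Hom J I) (x y : Hom I X) :
  idm I ∈ im e -> x ∘ e = y ∘ e -> x = y.
Proof.
move=> he exy.
have hm : mono ⟨idm X, idm X⟩.
  by move=> K a b; rewrite !pair_comp !comp_idl => /pair_inj [].
have [k] : ⟨x, y⟩ ∈ {| sub_map := ⟨idm X, idm X⟩; sub_mono := hm |}.
  apply: (mem_cover he); exists (x ∘ e); rewrite /= !pair_comp !comp_idl.
  by rewrite {2}exy.
by rewrite /= pair_comp !comp_idl => /pair_inj [<- <-].
Qed.

Lemma mem_im_cover (I X Y : H) (f : Hom X Y) (z : Hom I Y) :
  z ∈ im f -> idm I ∈ im (pb1 z f).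
Proof.
move=> hz; case: (im_stable f z) => h _; apply: (mem_le h).
by apply/mem_pull; rewrite comp_idr.
Qed.

(** The kernel pair of [e] serves: if [f] agrees on that pair, the image [R] of [⟨e, f⟩] is the
    graph of the required arrow. *)
Lemma cover_regular_epi (X Y : H) (e : Hom X Y) : idm Y ∈ im e -> regular_epi e.
Proof.
move=> he; exists (pb e e), (pb1 e e), (pb2 e e); split; first exact: pb_comm.
move=> Z f ef.
have funct : forall I (x y : Hom I X), e ∘ x = e ∘ y -> f ∘ x = f ∘ y.
  by move=> I x y /pb_lift [k [<- <-]]; rewrite !comp_assoc ef.
set R := im ⟨e, f⟩.
(* Single-valuedness: on a common cover both [r] and [r'] come from [X], where the value of [f]
   depends only on that of [e]. *)
have hR : forall I (r r' : Hom I (Y ⊗ Z)), r ∈ R -> r' ∈ R -> pi1 ∘ r = pi1 ∘ r' -> r = r'.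
  move=> I r r' hr hr' e1;
  apply: (cover_epi (mem_im_cover hr)).
  apply: (cover_epi (mem_im_cover (mem_comp (pb1 r ⟨e, f⟩) hr'))).
  set h := pb1 r _; set g := pb1 (r' ∘ h) _.
  have [x ex] : exists x, r ∘ h ∘ g = ⟨e ∘ x, f ∘ x⟩.
    by exists (pb2 r ⟨e, f⟩ ∘ g); rewrite /h pb_comm !comp_assoc -!pair_comp.
  have [x' ex'] : exists x, r' ∘ h ∘ g = ⟨e ∘ x, f ∘ x⟩.
    by exists (pb2 (r' ∘ h) ⟨e, f⟩); rewrite /g pb_comm pair_comp.
  rewrite ex ex'; suff e2 : e ∘ x = e ∘ x' by rewrite e2 (funct _ _ _ e2).
  rewrite -(pi1_pair (e ∘ x) (f ∘ x)) -(pi1_pair (e ∘ x') (f ∘ x')) -ex -ex'.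
  by rewrite !comp_assoc e1.
have hU : mono (pi1 ∘ R).
  move=> I a b; rewrite -!comp_assoc => eab; apply: (@sub_mono _ _ R).
  by apply: hR => //; [exists a|exists b].
have [l hl] : ⟨e, f⟩ ∈ R := im_fact ⟨e, f⟩.
(* Totality: the cover [e] factors through the mono [pi1 ∘ R], so [idm Y] does too. *)
have [k hk] : idm Y ∈ {| sub_map := pi1 ∘ R; sub_mono := hU |}.
  by apply: (mem_cover he); exists l; rewrite /= -comp_assoc hl pi1_pair comp_idl.
rewrite /= in hk.
have hke : ⟨e, f⟩ = R ∘ k ∘ e.
  apply: hR; first by exists l.
    by exists (k ∘ e); rewrite comp_assoc.
  by rewrite pi1_pair !comp_assoc hk comp_idl.
exists (pi2 ∘ R ∘ k); split; first by rewrite -!comp_assoc (comp_assoc e) -hke pi2_pair.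
move=> k' hk'; apply: (cover_epi he).
by rewrite hk' -!comp_assoc (comp_assoc e) -hke pi2_pair.
Qed.

End Covers.

(** * Local arguments along supine arrows and images *)

Section LocalReasoning.
Variables (E : Cat) (H : HeytingCat) (F : Functor E H).
Hypothesis hF : fibred_locale F.
Let hf : faithful F := fl_faithful hF.

Lemma supine_elim (P Q : E) (f : Hom P Q) (Z W : H) (v : Hom Z (F Q)) (w : Hom Z W)
    (R : Over F Z) (T : Over F W) :
  supine F f -> mor v R (reify Q) ->
  (forall J (h : Hom J Z) (k : Hom J (F P)) (S : Over F J), v ∘ h = fmor F f ∘ k ->
     mor h S R -> mor k S (reify P) -> mor (w ∘ h) S T) ->
  mor w R T.
Proof.
move=> /(supineP hf) hs hv hl.
have hQ : mor (idm _) (reify Q) (coix hF (fmor F f) (reify P)).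
  by apply: hs; rewrite comp_idl; apply: mor_coix_id.
exact: (mor_cover (mor_le hv hQ) hl).
Qed.

Hypothesis hsep : separated F.

(** The pullback [e] of [f] along [z] is a regular epimorphism, so separatedness gives [∃_e ⊤ ≃ ⊤];
    as [R ≤ ⊤], [mor_cover] applies. *)
Lemma mor_local (I X Y W : H) (f : Hom X Y) (z : Hom I Y) (w : Hom I W)
    (R : Over F I) (Q : Over F W) :
  z ∈ im f ->
  (forall J (h : Hom J I) (x : Hom J X) (S : Over F J), z ∘ h = f ∘ x ->
     mor h S R -> mor (w ∘ h) S Q) ->
  mor w R Q.
Proof.
move=> /mem_im_cover hz hl; set e := pb1 z f in hz.
have ht := hsep (cover_regular_epi hz) (@top_is _ _ _ hF _) (coix_is hF e (top hF _)).
apply: (mor_cover (u := e) (v := idm I) (P := top hF _) (ht R)) => J h k S.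
rewrite comp_idl => -> hS _.
apply: (hl _ _ (pb2 z f ∘ k)) => //.
by rewrite !comp_assoc pb_comm.
Qed.

End LocalReasoning.

(** * Families of downsets as objects of the fibred locale *)

Section Realizability.
Variables (E : Cat) (H : HeytingCat) (F : Functor E H).
Hypothesis hF : fibred_locale F.
Let hf : faithful F := fl_faithful hF.
Variables (A : OPAS H) (C : Over F A).

(** The projection [C × Z → Z] is restricted along a prone arrow over [Y]. As [F (pr_ob e)] is the
    domain of [Y] only up to transport, the conclusions describe it by its elements. *)
Lemma prodo_of_family (Z : E) (Y : Family A (F Z)) : exists e : Prodo C Z,
  let r := eq_hom (ov_eq C) ∘ fmor F (pr_real e) in
  let m := fmor F (pr_map e) in
  ⟨r, m⟩ ∈ Y /\
  (forall I (x : Hom I (A ⊗ F Z)), x ∈ Y -> exists i, r ∘ i = pi1 ∘ x /\ m ∘ i = pi2 ∘ x) /\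
  (forall I (v : Hom I (F (pr_ob e))) (R : Over F I),
     mor (r ∘ v) R C -> mor (m ∘ v) R (reify Z) -> mor v R (reify (pr_ob e))).
Proof.
case: (product_over hF C (reify Z)) => p [q [hp [hq hpq]]].
case: (reix_is hF Y (meet hF (reix hF pi1 C) (reix hF pi2 (reify Z)))).
set W := reix _ _ _ => m [hm hmp].
have hr := lies_over_comp hm hp; have hs := lies_over_comp hm hq.
have e : ⟨eq_hom (ov_eq C) ∘ fmor F (p ∘ m), fmor F (q ∘ m)⟩ = Y ∘ eq_hom (ov_eq W).
  rewrite -(pair_eta (Y ∘ _)) !comp_assoc -hr.
  by move: hs; rewrite /lies_over /= comp_idl => <-.
have hm_mono : mono m.
  move=> I x y exy.
  case: (lies_over_exists (P := reify (F := F) I) x) => u hu.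
  case: (lies_over_exists (P := reify (F := F) I) y) => v hv.
  apply: (lies_over_inj hf hu); suff -> : u = v by [].
  apply: (@sub_mono _ _ Y); apply: lies_over_unique (lies_over_comp hu hm) _.
  by rewrite exy; apply: lies_over_comp hv hm.
have hd : down_closed ⟨eq_hom (ov_eq C) ∘ fmor F (p ∘ m), fmor F (q ∘ m)⟩.
  rewrite e => I a a' x; rewrite !mem_eq_hom; exact: fam_down.
have hpm : exists (P : E) (p' : Hom P C) (q' : Hom P Z) (m' : Hom W P),
    is_product p' q' /\ mono m' /\ prone F m' /\ p' ∘ m' = p ∘ m /\ q' ∘ m' = q ∘ m.
  by exists _, p, q, m.
exists {| pr_ob := W; pr_real := p ∘ m; pr_map := q ∘ m; pr_prone_mono := hpm; pr_down := hd |}.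
rewrite /=; split; [|split].
- by rewrite e; exists (eq_hom (ov_eq W)).
- move=> I x [k <-]; exists (eq_hom (eq_sym (ov_eq W)) ∘ k).
  have ek : Y ∘ k = Y ∘ eq_hom (ov_eq W) ∘ (eq_hom (eq_sym (ov_eq W)) ∘ k).
    by rewrite -comp_assoc (comp_assoc k) eq_hom_symr comp_idl.
  by rewrite ek -e !comp_assoc pi1_pair pi2_pair.
- move=> I v R h1 h2; apply/mor_to_reify.
  rewrite !mor_reix mor_meet !mor_reix !comp_assoc -hr.
  move: hs; rewrite /lies_over /= comp_idl => <-.
  by split.
Qed.

(** The object [∃_{Y → X} C_Y] of the fibre over [X]. *)
Definition fam_ob (X : H) (Y : Family A X) : Over F X :=
  coix hF (pi2 ∘ Y) (reix hF (pi1 ∘ Y) C).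

(** Internally [fam_ob Y] is [{x | ∃ a. C(a) ∧ (a, x) ∈ Y}]; this lemma and the next are the
    introduction and elimination rules of the quantifier. *)
Lemma fam_intro (X I : H) (Y : Family A X) (a : Hom I A) (x : Hom I X) (R : Over F I) :
  ⟨a, x⟩ ∈ Y -> mor a R C -> mor x R (fam_ob Y).
Proof.
move=> [k hk] ha; have -> : x = pi2 ∘ Y ∘ k by rewrite -comp_assoc hk pi2_pair.
apply: mor_comp (mor_coix_id hF _ _); apply/mor_reix.
by rewrite -comp_assoc hk pi1_pair.
Qed.

Lemma fam_elim (X I W : H) (Y : Family A X) (x : Hom I X) (w : Hom I W)
    (R : Over F I) (Q : Over F W) :
  mor x R (fam_ob Y) ->
  (forall J (h : Hom J I) (a : Hom J A) (S : Over F J), ⟨a, x ∘ h⟩ ∈ Y ->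
     mor h S R -> mor a S C -> mor (w ∘ h) S Q) ->
  mor w R Q.
Proof.
move=> hx hl; apply: (mor_cover hx) => J h k S e hS /mor_reix ha.
apply: (hl _ _ _ _ _ hS ha); exists k.
by rewrite e -[LHS]pair_eta !comp_assoc.
Qed.

Lemma mor_from_fam (X W : H) (Y : Family A X) (w : Hom X W) (Q : Over F W) :
  (forall J (a : Hom J A) (x : Hom J X) (S : Over F J), ⟨a, x⟩ ∈ Y -> mor a S C ->
     mor (w ∘ x) S Q) ->
  mor w (fam_ob Y) Q.
Proof.
move=> hl; apply: fam_elim (mor_id (fam_ob Y)) _ => J h a S.
by rewrite comp_idl => hY _; apply: hl.
Qed.

Hypothesis hC : vertical_filter C.

Lemma filter_mor_le (I : H) (x y : Hom I A) (S : Over F I) :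
  ⟨x, y⟩ ∈ leq A -> mor x S C -> mor y S C.
Proof.
move=> [k hk] hx.
have := proj1 hC _ _ (reix_is hF _ C) (reix_is hF _ C) => /reix_le.
have -> : y = pi2 ∘ leq A ∘ k by rewrite -comp_assoc hk pi2_pair.
move=> h; apply: mor_comp h; apply/mor_reix.
by rewrite -comp_assoc hk pi1_pair.
Qed.

Lemma filter_mor_app (I : H) (x y z : Hom I A) (S : Over F I) :
  pm_val (app A) ⟨x, y⟩ z -> mor x S C -> mor y S C -> mor z S C.
Proof.
move=> [k [hk <-]] hx hy.
have := proj2 hC _ _ _ _ (reix_is hF _ C) (reix_is hF _ C) (meet_is hF _ _) (reix_is hF _ C).
move=> /reix_le h; apply: mor_comp h; apply/mor_meet; rewrite !mor_reix.
by rewrite -!comp_assoc hk pi1_pair pi2_pair.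
Qed.

Variable phi : Sub A -> Prop.
Hypothesis hrep : represents C phi.

Let T : E := ov_ob (top hF one).
Let hT : is_terminal T := top_terminal hF.

Lemma terminal_base (I : H) (x y : Hom I (F T)) : x = y.
Proof.
case: (one_terminal I) => o [_ ho].
have e : eq_hom (ov_eq (top hF one)) ∘ x = eq_hom (ov_eq (top hF one)) ∘ y.
  by rewrite -(ho (_ ∘ x)) // -(ho (_ ∘ y)).
by rewrite -(comp_idl x) -(comp_idl y) -(eq_hom_syml (ov_eq (top hF one)))
  -!comp_assoc e.
Qed.

Lemma mor_terminal (I : H) (x : Hom I (F T)) (R : Over F I) : mor x R (reify T).
Proof. apply/mor_to_reify; exact: mor_top. Qed.

Lemma terminal_point (I : H) : exists x : Hom I (F T), True.
Proof.
case: (one_terminal I) => o _.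
by exists (eq_hom (eq_sym (ov_eq (top hF one))) ∘ o).
Qed.

(** * Tracked arrows and arrows between the associated objects *)

Lemma trackable_mor (hphi : external_filter phi) (X X' : H) (Y : Family A X)
    (Y' : Family A X') (f : Hom X X') :
  trackable phi Y Y' f -> mor f (fam_ob Y) (fam_ob Y').
Proof.
move=> [U [hU hY]]; apply: mor_from_fam => J a x S ha hS.
case: (hT (reix hF U C)) => t _.
have ht : supine F t.
  by apply/(hrep (filter_down hphi hU) (reix_is hF U C) t hT).
case: (terminal_point J) => o _.
(* As [C_U → 1] is supine, a [u ∈ U] with [C(u)] may be assumed after a change of stage. *)
apply: (supine_elim hF ht (mor_terminal o S)) => K h k S' _ hh hk.
have {}hk : mor (U ∘ (eq_hom (ov_eq (reix hF U C)) ∘ k)) S' C.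
  by apply/mor_reix/mor_to_reify.
case: (hY _ (U ∘ (eq_hom (ov_eq (reix hF U C)) ∘ k)) (a ∘ h) (x ∘ h)).
- by exists (eq_hom (ov_eq (reix hF U C)) ∘ k).
- by rewrite -pair_comp; apply: mem_comp.
- move=> b [hb hbY]; apply: (fam_intro (a := b)); first by rewrite -comp_assoc.
  exact: filter_mor_app hb hk (mor_comp hh hS).
Qed.

Lemma mor_trackable (hchurch : church_rule C) (hunif : uniformity_rule C)
    (X X' : H) (Y : Family A X) (Y' : Family A X') (f : Hom X X') :
  mor f (fam_ob Y) (fam_ob Y') -> trackable phi Y Y' f.
Proof.
move=> hfm; pose CY := reix hF (pi1 ∘ Y) C.
pose j : Hom (F CY) (sub_ob Y) := eq_hom (ov_eq CY).
pose j' : Hom (sub_ob Y) (F CY) := eq_hom (eq_sym (ov_eq CY)).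
have hj : j ∘ j' = idm _ by apply: eq_hom_symr.
(* Pulling [Y'] back along [s] gives [{(b, (a, x)) | (b, f x) ∈ Y'}] as a family over [F CY]. *)
pose s := ⟨pi1 (Y := F CY), f ∘ pi2 ∘ Y ∘ j ∘ pi2⟩ : Hom (A ⊗ F CY) (A ⊗ X').
have memS : forall I (b : Hom I A) (y : Hom I (F CY)),
    ⟨b, y⟩ ∈ sub_pull s Y' <-> ⟨b, f ∘ pi2 ∘ Y ∘ j ∘ y⟩ ∈ Y'.
  by move=> I b y; rewrite mem_pull /s pair_comp -!comp_assoc pi1_pair pi2_pair.
have hd : down_closed (A := A) (sub_pull s Y').
  by move=> I a a' x hl /memS hx; apply/memS; apply: fam_down hl hx.
case: (prodo_of_family (Z := CY) {| fam_sub := sub_pull s Y'; fam_down := hd |}) => f1.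
set r1 := _ ∘ fmor F (pr_real f1); set m1 := fmor F (pr_map f1).
move=> /= [h1 [h2 h3]].
(* The hypothesis provides, over each element of [CY], some [b] with [C(b)] and [(b, f x) ∈ Y']. *)
have hs1 : supine F (pr_map f1).
  apply/(supineP hf) => Z v R hR.
  have hCY : mor (f ∘ pi2 ∘ Y ∘ j) (reify CY) (fam_ob Y').
    rewrite -!comp_assoc; apply: mor_comp hfm; rewrite comp_assoc.
    exact: mor_comp (reify_over CY) (mor_coix_id hF _ _).
  apply: (fam_elim hCY) => J h a S ha hS haC.
  case: (h2 _ ⟨a, h⟩); first by apply/memS.
  move=> i; rewrite pi1_pair pi2_pair => -[i1 i2].
  rewrite -i2 comp_assoc; apply: mor_comp hR.
  by apply: h3; rewrite ?i1 // i2.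
(* [g : CY → C] takes the [a]-component and is prone, so the uniformity rule yields pairs [(b, a)],
   supine over [C], that serve every [x] with [(a, x) ∈ Y]. *)
case: (reix_is hF (pi1 ∘ Y) C) => g [hg hgp].
case: (hunif _ _ f1 g hs1 hgp) => e [hes he].
(* For Church's rule, [C] is presented as a prodo morphism into the terminal object, with [C] itself
   as the product [C × 1]. *)
case: (hT C) => t _.
have hpm : exists (P : E) (p : Hom P C) (q : Hom P T) (m : Hom C P),
    is_product p q /\ mono m /\ prone F m /\ p ∘ m = idm C /\ q ∘ m = t.
{ exists C, (idm _), t, (idm _); split; [|split; [|split; [|split]]].
  - move=> I x y; exists x; split; last by move=> x' [<- _]; rewrite comp_idl.
    split; first exact: comp_idl.
    by case: (hT I) => o [_ ho]; rewrite -(ho (t ∘ x)) // -(ho y).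
  - exact: id_mono.
  - by apply/(proneP hf) => Z v R; rewrite fmor_id comp_idl.
  - exact: comp_idl.
  - exact: comp_idr. }
have hd0 : down_closed ⟨eq_hom (ov_eq C) ∘ fmor F (idm C), fmor F t⟩.
  move=> I a a' x _ _; exists (eq_hom (eq_sym (ov_eq C)) ∘ a).
  rewrite pair_comp fmor_id comp_idr comp_assoc eq_hom_symr comp_idl.
  by rewrite (terminal_base (_ ∘ _) x).
pose g0 := {| pr_ob := C; pr_real := idm C; pr_map := t; pr_prone_mono := hpm;
              pr_down := hd0 |} : Prodo C T.
(* An element of [pr_ob e2] is a [u] such that, for every [a], [u a] is defined and [(u a, a)] lies
   in [pr_ob e]. *)
case: (hchurch T g0 e hes) => e2 [hs2 he2].
pose r2 := eq_hom (ov_eq C) ∘ fmor F (pr_real e2).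
(* Tracking concerns base elements, so the arrows from the two rules are mapped to the base and
   evaluated at [(u, a)], then at [((u a, a), (a, x))]. *)
have key : forall I (u a : Hom I A) (x : Hom I X) (v : Hom I (F (pr_ob e2))),
    u = r2 ∘ v -> ⟨a, x⟩ ∈ Y ->
    exists b, pm_val (app A) ⟨u, a⟩ b /\ ⟨b, f ∘ x⟩ ∈ Y'.
  move=> I u a x v eu [y hy].
  case: (pullback_point hF (pr_map e2) t) => M [q1 [q2 [hpb hM]]].
  case: (he2 _ _ _ hpb) => k [hk hval].
  case: (hM _ v (eq_hom (eq_sym (ov_eq C)) ∘ a)); first exact: terminal_base.
  move=> i [i1 i2].
  case: (pullback_point hF (pr_map e) g) => M' [q1' [q2' [hpb' hM']]].
  case: (he _ _ _ hpb') => k' [hk' hr'].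
  have ea : a = pi1 ∘ Y ∘ y by rewrite -comp_assoc hy pi1_pair.
  case: (hM' _ (fmor F k ∘ i) (j' ∘ y)).
    rewrite comp_assoc -fmor_comp hk i2 ea.
    have -> : fmor F g = eq_hom (eq_sym (ov_eq C)) ∘ (pi1 ∘ Y ∘ j).
      by rewrite -hg comp_assoc eq_hom_syml comp_idl.
    by rewrite -!comp_assoc (comp_assoc y j' j) hj comp_idl.
  move=> i' [i1' i2']; exists (r1 ∘ (fmor F k' ∘ i')).
  have er : r1 ∘ (fmor F k' ∘ i') = eq_hom (ov_eq C) ∘ fmor F (pr_real e ∘ k) ∘ i.
    rewrite /r1 -!comp_assoc (comp_assoc i') -fmor_comp hr' !fmor_comp.
    by rewrite -!comp_assoc i1'.
  have em : m1 ∘ (fmor F k' ∘ i') = j' ∘ y by rewrite comp_assoc -fmor_comp hk'.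
  rewrite er; split.
    have := pm_val_comp i hval.
    rewrite pair_comp /= !fmor_comp fmor_id -!comp_assoc i1 comp_idl i2.
    rewrite (comp_assoc a) eq_hom_symr comp_idl.
    by rewrite comp_assoc -/r2 -eu.
  have := mem_comp (fmor F k' ∘ i') h1; rewrite pair_comp em er => /memS.
  by rewrite -!comp_assoc (comp_assoc y j' j) hj comp_idl hy pi2_pair.
(* The set of trackers is [im r2]. All elements of [F T] agree, so downward closure of the prodo
   morphism in [A × F T] passes to [A]. *)
have hV : downset (im r2).
  move=> I a a' hl ha'; apply: (mem_cover (mem_im_cover ha')).
  set h := pb1 _ _.
  case: (terminal_point (pb a' r2)) => o _.
  have [k hk] : ⟨a ∘ h, o⟩ ∈ ⟨r2, fmor F (pr_map e2)⟩.
    apply: (pr_down (p := e2) (a' := a' ∘ h)).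
      by rewrite -pair_comp; apply: mem_comp.
    exists (pb2 a' r2); rewrite /h pb_comm pair_comp.
    by rewrite (terminal_base (_ ∘ _) o).
  move: hk; rewrite pair_comp => /pair_inj [<- _].
  exact: mem_comp (im_fact r2).
case: (im_fact r2) => l hl.
exists (im r2); split.
  pose CV := reix hF (im r2) C; case: (hT CV) => t' _.
  (* The supine arrow from [pr_ob e2] to [T] factors through [CV → T], which is therefore supine; as
     [C] represents [phi], this puts [im r2] in [phi]. *)
  apply/(hrep hV (reix_is hF (im r2) C) t' hT); apply/(supineP hf) => Z v R hR.
  apply: (proj1 (supineP hf _) hs2).
  have hl' : mor (eq_hom (eq_sym (ov_eq CV)) ∘ l) (reify (pr_ob e2)) (reify CV).
    apply/mor_to_reify; rewrite comp_assoc eq_hom_symr comp_idl.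
    apply/mor_reix; rewrite hl; exact: mor_comp (mor_fmor F (pr_real e2)) (reify_over C).
  apply: mor_eq (mor_comp hl' hR) _.
  by rewrite -comp_assoc (terminal_base (fmor F t' ∘ _) (fmor F (pr_map e2))).
move=> I u a x hu hY.
(* An element of [im r2] lifts to [pr_ob e2] only on a cover; definedness of [u a] and membership in
   [Y'] descend, being memberships in subobjects. *)
have loc : forall J (h : Hom J I) (v : Hom J (F (pr_ob e2))), u ∘ h = r2 ∘ v ->
    exists b, pm_val (app A) ⟨u ∘ h, a ∘ h⟩ b /\ ⟨b, f ∘ x ∘ h⟩ ∈ Y'.
  move=> J h v e'; case: (key _ _ (a ∘ h) (x ∘ h) v e').
    by rewrite -pair_comp; apply: mem_comp.
  by move=> b; rewrite comp_assoc; exists b.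
case: (loc _ _ _ (pb_comm u r2)) => b [hb hbY].
have /pm_domP [c hc] : ⟨u, a⟩ ∈ pm_dom (app A).
  apply: (mem_cover (mem_im_cover hu)).
  by rewrite pair_comp; apply/pm_domP; exists b.
exists c; split=> //; apply: (mem_cover (mem_im_cover hu)).
have := pm_val_comp (pb1 u r2) hc; rewrite !pair_comp => hc'.
by rewrite (pm_val_fun hc' hb).
Qed.

(** The down closure of the image of [⟨p, s⟩ : F P → A × F X], for a weakly generic
    span [C ← P → X]. *)
Lemma fam_exists (hsep : separated F) (hgen : weakly_generic F C) (X : E) :
  exists Y : Family A (F X), fib_eq (fam_ob Y) (reify X).
Proof.
case: (hgen X) => P [p [s [hp hs]]].
pose a0 := eq_hom (ov_eq C) ∘ fmor F p.
(* [pb l a0] consists of the pairs [(a, y)] with [a ≤ a0 y], and [m] sends such a pair to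
   [(a, F s y)]. *)
pose l := pi2 ∘ leq A.
pose m := ⟨pi1 ∘ leq A ∘ pb1 l a0, fmor F s ∘ pb2 l a0⟩.
have em2 : pi2 ∘ m = fmor F s ∘ pb2 l a0 := pi2_pair _ _.
have hm : forall I (a : Hom I A) (y : Hom I (F P)), ⟨a, a0 ∘ y⟩ ∈ leq A ->
    ⟨a, fmor F s ∘ y⟩ ∈ im m.
  move=> I a y [k hk].
  have [i [i1 i2]] : exists i, pb1 l a0 ∘ i = k /\ pb2 l a0 ∘ i = y.
    by apply: pb_lift; rewrite /l -comp_assoc hk pi2_pair.
  suff -> : ⟨a, fmor F s ∘ y⟩ = m ∘ i by apply: mem_comp; apply: im_fact.
  by rewrite pair_comp -!comp_assoc i1 i2 hk pi1_pair.
have hmE : forall J (x : Hom J (pb l a0)),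
    ⟨pi1 ∘ m ∘ x, a0 ∘ (pb2 l a0 ∘ x)⟩ ∈ leq A.
  move=> J x; exists (pb1 l a0 ∘ x).
  by rewrite /m pi1_pair (comp_assoc x (pb2 l a0)) -pb_comm -[LHS]pair_eta !comp_assoc.
have hd : down_closed (A := A) (im m).
  move=> I a a' x hl hx; apply: (mem_cover (mem_im_cover hx)).
  set h := pb1 _ _; set q := pb2 ⟨a', x⟩ m.
  have e : ⟨a' ∘ h, x ∘ h⟩ = m ∘ q by rewrite -pair_comp pb_comm.
  have [ea ex] : a' ∘ h = pi1 ∘ m ∘ q /\ x ∘ h = pi2 ∘ m ∘ q.
    by rewrite -!comp_assoc -e pi1_pair pi2_pair.
  rewrite pair_comp ex em2 -comp_assoc; apply: hm.
  apply: (leq_trans (y := a' ∘ h)); first by rewrite -pair_comp; apply: mem_comp.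
  by rewrite ea; apply: hmE.
exists {| fam_sub := im m; fam_down := hd |}; split.
  (* Locally [x = F s y] and [a ≤ a0 y]; as [C] is upward closed and [p] prone, [y] lies in [P], and
     [s] carries it into [X]. *)
  apply: mor_from_fam => J a x S /= hY ha; rewrite comp_idl.
  apply: (mor_local hF hsep hY) => K h y S' e hS.
  move: e; rewrite pair_comp => e.
  have ex : x ∘ h = fmor F s ∘ (pb2 l a0 ∘ y).
    by rewrite -(pi2_pair (a ∘ h) (x ∘ h)) e comp_assoc em2 comp_assoc.
  have ea : a ∘ h = pi1 ∘ m ∘ y.
    by rewrite -(pi1_pair (a ∘ h) (x ∘ h)) e comp_assoc.
  rewrite ex; apply: mor_comp (mor_fmor F s).
  apply: (proj1 (proneP hf _) hp); apply/mor_to_reify; rewrite comp_assoc.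
  apply: filter_mor_le (hmE _ y) _; rewrite -ea; exact: mor_comp hS ha.
(* As [s] is supine it suffices to map [P], where [y] is realized by [a0 y] itself, [≤] being
   reflexive. *)
apply: (proj1 (supineP hf _) hs); rewrite comp_idl.
have ha0 : mor a0 (reify P) C by apply: mor_comp (mor_fmor F p) (reify_over C).
apply: fam_intro ha0; rewrite /= -(comp_idr (fmor F s)).
by apply: hm; rewrite comp_idr; apply: leq_refl.
Qed.

End Realizability.

(** * Fibred equivalences from full maps on objects *)

Lemma eq_hom_trans (B : Cat) (X Y Z : B) (e : X = Y) (e' : Y = Z) :
  eq_hom (eq_trans e e') = eq_hom e' ∘ eq_hom e.
Proof. by case: Z / e'; rewrite comp_idl. Qed.

Lemma eq_hom_sym_trans (B : Cat) (X Y Z : B) (e : X = Y) (e' : Y = Z) :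
  eq_hom e ∘ eq_hom (eq_sym (eq_trans e e')) = eq_hom (eq_sym e').
Proof. by case: Z / e'; rewrite eq_hom_symr. Qed.

Lemma over_reify (B E : Cat) (F : Functor E B) (X : B) (P : Over F X) :
  mor (eq_hom (eq_sym (ov_eq P))) P (reify P).
Proof. by apply/mor_to_reify; rewrite eq_hom_symr; apply: mor_id. Qed.

Section FibredEquivalence.
Variable B : Cat.

(** A map [g] of objects over [B] extends to a fully faithful functor over [B]. *)
Definition full_over {D E : Cat} {P : Functor D B} {Q : Functor E B}
    (g : forall X : D, Over Q (P X)) : Prop :=
  forall (X Y : D) (u : Hom (P X) (P Y)),
    mor u (reify X) (reify Y) <-> mor u (g X) (g Y).

(** [g (k X)] is vertically isomorphic to [X], up to the equality [P (k X) = Q X]. *)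
Definition section_over {D E : Cat} {P : Functor D B} {Q : Functor E B}
    (g : forall X : D, Over Q (P X)) (k : forall X : E, Over P (Q X)) : Prop :=
  forall X : E, mor (eq_hom (ov_eq (k X))) (g (k X)) (reify X) /\
                mor (eq_hom (eq_sym (ov_eq (k X)))) (reify X) (g (k X)).

(** As [g] is full, arrows [k X → k Y] correspond to arrows [g (k X) → g (k Y)], and these to arrows
    [X → Y] by conjugation with [g (k X) ≅ X]. *)
Lemma section_full (D E : Cat) (P : Functor D B) (Q : Functor E B)
    (g : forall X : D, Over Q (P X)) (k : forall X : E, Over P (Q X)) :
  full_over g -> section_over g k -> full_over k.
Proof.
move=> hg hk X Y u; split=> h.
  apply/(mor_from_reify u (k Y) (k X)); apply: mor_eq.
    apply: mor_comp (reify_over (k Y)); apply/hg.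
    exact: (mor_comp (mor_comp (proj1 (hk X)) h) (proj2 (hk Y))).
  by rewrite !comp_assoc eq_hom_symr comp_idl.
have h' := mor_comp (mor_comp (reify_over (k X)) h) (over_reify (k Y)).
apply: mor_eq (mor_comp (mor_comp (proj2 (hk X)) (proj1 (hg _ _ _) h')) (proj1 (hk Y))) _.
rewrite !comp_assoc eq_hom_symr comp_idl -!comp_assoc eq_hom_symr.
by rewrite comp_idr.
Qed.

(** Fullness of [g] reflects the isomorphism [g (k (g X)) ≅ g X] to [k (g X) ≅ X]. *)
Lemma section_over_sym (D E : Cat) (P : Functor D B) (Q : Functor E B)
    (g : forall X : D, Over Q (P X)) (k : forall X : E, Over P (Q X)) :
  full_over g -> section_over g k -> section_over k g.
Proof.
move=> hg hk X; split.
  apply/(mor_from_reify _ _ (k (g X)))/hg.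
  exact: mor_comp (proj1 (hk (g X))) (reify_over (g X)).
have h : mor (eq_hom (eq_sym (ov_eq (k (g X)))) ∘ eq_hom (eq_sym (ov_eq (g X))))
    (reify X) (reify (k (g X))).
  apply/hg; exact: mor_comp (over_reify (g X)) (proj2 (hk (g X))).
apply: mor_eq (mor_comp h (reify_over (k (g X)))) _.
by rewrite comp_assoc eq_hom_symr comp_idl.
Qed.

Section Lift.
Variables (D E : Cat) (P : Functor D B) (Q : Functor E B).
Hypotheses (hP : faithful P) (hQ : faithful Q).
Variable g : forall X : D, Over Q (P X).
Hypothesis hg : full_over g.

Lemma lift_exists (X Y : D) (f : Hom X Y) :
  exists f' : Hom (g X) (g Y), lies_over (fmor P f) f'.
Proof. by apply/hg; apply: mor_fmor. Qed.

(** The choice is harmless: faithfulness of [Q] makes the lift unique, whence functoriality. *)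
Definition lift_mor (X Y : D) (f : Hom X Y) : Hom (g X) (g Y) :=
  proj1_sig (constructive_indefinite_description _ (lift_exists f)).

Lemma lift_morP (X Y : D) (f : Hom X Y) : lies_over (fmor P f) (lift_mor f).
Proof. by rewrite /lift_mor; case: constructive_indefinite_description. Qed.

Lemma lift_mor_id (X : D) : lift_mor (idm X) = idm (g X : E).
Proof.
apply: (lies_over_inj hQ (lift_morP _)).
by rewrite /lies_over !fmor_id comp_idl comp_idr.
Qed.

Lemma lift_mor_comp (X Y Z : D) (f : Hom X Y) (f' : Hom Y Z) :
  lift_mor (f' ∘ f) = lift_mor f' ∘ lift_mor f.
Proof.
apply: (lies_over_inj hQ (lift_morP _)); rewrite fmor_comp.
exact: lies_over_comp (lift_morP f) (lift_morP f').
Qed.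

Definition lift_functor : Functor D E :=
  {| fob := fun X : D => g X : E; fmor := lift_mor;
     fmor_id := lift_mor_id; fmor_comp := lift_mor_comp |}.

Lemma lift_fibred (k : forall X : E, Over P (Q X)) :
  section_over g k -> fibred_functor P Q lift_functor.
Proof.
move=> hk; split.
  by exists (fun X => ov_eq (g X)) => X Y f; apply: lift_morP.
move=> X Y f /(proneP hP) hf; apply/(proneP hQ) => Z v [R eR]; subst Z => hR.
apply/mor_to_reify; rewrite -/(reify R).
set w := _ ∘ v.
(* The test object [R] is replaced by [g (k R)], so that proneness of [f] can be applied to
   [k R]. *)
have hw : mor (w ∘ eq_hom (ov_eq (k R))) (reify (k R)) (reify X).
  apply: hf; apply/hg; have := mor_comp (mor_comp (proj1 (hk R)) hR) (reify_over (g Y)).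
  move/mor_eq; apply; rewrite /w !comp_assoc; do 2!congr (_ ∘ _).
  exact: lift_morP.
have := mor_comp (proj2 (hk R)) (proj1 (hg _) hw).
move/mor_eq; apply; by rewrite -comp_assoc eq_hom_symr comp_idr.
Qed.

End Lift.

(** Each component lies over an equality of base objects; naturality and invertibility are checked
    in the base, [P] being faithful. *)
Lemma lift_nat_iso (D E : Cat) (P : Functor D B) (Q : Functor E B)
    (hP : faithful P) (hQ : faithful Q)
    (g : forall X : D, Over Q (P X)) (k : forall X : E, Over P (Q X))
    (hg : full_over g) (hk : full_over k) :
  section_over k g ->
  vertical_nat_iso P (functor_comp (lift_functor hP hk) (lift_functor hQ hg)) (functor_id D).
Proof.
move=> hs.
have hv : forall X : D, exists f : Hom (k (g X)) X,
    fmor P f = eq_hom (eq_trans (ov_eq (k (g X))) (ov_eq (g X))).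
  move=> X; apply/(mor_reify (F := P)); rewrite eq_hom_trans.
  by apply/mor_from_reify; apply: (proj1 (hs X)).
exists (fun X => proj1_sig (constructive_indefinite_description _ (hv X))); split.
  move=> X Y f; case: constructive_indefinite_description => eY /= hY.
  case: constructive_indefinite_description => eX /= hX.
  apply: hP; rewrite !fmor_comp hX hY !eq_hom_trans.
  have /= h1 := lift_morP hk (lift_mor hg f); have /= h2 := lift_morP hg f.
  rewrite /lies_over in h1 h2.
  by rewrite -comp_assoc h1 !comp_assoc h2.
move=> X; case: constructive_indefinite_description => f /= hf; split; last first.
  by exists (eq_trans (ov_eq (k (g X))) (ov_eq (g X))).
have [f' hf'] : exists f' : Hom X (k (g X) : D),
    fmor P f' = eq_hom (eq_sym (eq_trans (ov_eq (k (g X))) (ov_eq (g X)))).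
  apply/(mor_reify (F := P))/mor_to_reify; apply: mor_eq (proj2 (hs X)) _.
  by rewrite eq_hom_sym_trans.
exists f'; split; apply: hP; rewrite fmor_comp hf hf' fmor_id.
  exact: eq_hom_syml.
exact: eq_hom_symr.
Qed.

End FibredEquivalence.

(** * The equivalence between [F] and the realizability fibration *)

Lemma realizability_faithful (H : HeytingCat) (A : OPAS H) (phi : Sub A -> Prop)
    (hphi : external_filter phi) (hcc : comb_complete phi) :
  faithful (realizability_fibration hphi hcc).
Proof. by move=> X Y [f hf] [f' hf'] /= e; apply: subset_eq_compat. Qed.

Theorem theorem1p4p30 (H : HeytingCat) (A : OPAS H) (phi : Sub A -> Prop)
    (hphi : external_filter phi) (hcc : comb_complete phi)
    (E : Cat) (F : Functor E H)
    (hF : fibred_locale F) (hsep : separated F)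
    (C : Over F A) (hC : vertical_filter C) (hgen : weakly_generic F C)
    (hchurch : church_rule C) (hunif : uniformity_rule C)
    (hrep : represents C phi) :
  fibred_equivalent F (realizability_fibration hphi hcc).
Proof.
pose D := realizability_cat hphi hcc; pose P := realizability_fibration hphi hcc.
pose g (Y : D) : Over F (P Y) := fam_ob hF C (projT2 Y).
have hY := fam_exists hF hC hsep hgen.
pose k (X : E) : Over P (F X) :=
  {| ov_ob := existT _ (F X) (proj1_sig (constructive_indefinite_description _ (hY X))) : D;
     ov_eq := eq_refl |}.
have hP : faithful P := @realizability_faithful _ _ _ hphi hcc.
have hQ := fl_faithful hF.
(* Fullness of [g] says that being trackable is the same as being an arrow between the objects
   [fam_ob]. *)
have hg : full_over g.
  move=> X Y u; split.
    move/(mor_reify (F := P)) => [f <-].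
    exact: (trackable_mor hF hC hrep hphi (proj2_sig f)).
  move/(mor_trackable hrep hchurch hunif) => hu; apply/(mor_reify (F := P)).
  by exists (exist _ u hu).
have hk : section_over g k.
  by move=> X; rewrite /k /g /=; case: constructive_indefinite_description => Y [].
have hk' := section_full hg hk.
exists (lift_functor hP hk'), (lift_functor hQ hg); split; [|split; [|split]].
- exact: lift_fibred (section_over_sym hg hk).
- exact: lift_fibred hk.
- exact: lift_nat_iso hk.
- exact: lift_nat_iso (section_over_sym hg hk).
Qed.
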